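(* Let $(M,\xi,\lambda,g)$ be a compact and connected $n$-dimensional almost Ricci soliton ($n>2$) whose potential vector field $\xi$ is closed (in particular, gradient) and affine conformal Killing, i.e. $$\mathcal L_{\xi}\nabla=d\rho\otimes I+I\otimes d\rho-g\otimes\nabla\rho$$ for a smooth function $\rho$ on $M$. If $$\int_M\operatorname{Ric}(\xi,\xi)\geq n\int_M\rho\big((n-1)\rho+\operatorname{trace}(H)\big)+\frac{n-1}{4n}\int_M\big(\operatorname{trace}(H)\big)^2,$$ then $\xi$ is a conformal Killing vector field and the manifold is Einstein.
   Context: $(M,g)$ is a Riemannian manifold with Levi-Civita connection $\nabla$; $\nabla\rho$ is the gradient of $\rho$. The displayed condition on $\xi$ means $(\mathcal L_{\xi}\nabla)(X,Y)=X(\rho)Y+Y(\rho)X-g(X,Y)\nabla\rho$ for all vector fields $X,Y$; it is equivalent to $\mathcal L_{\xi}g=2\rho g+K$ with $K$ a symmetric $(0,2)$-tensor field satisfying $\nabla K=0$. $H$ is the $(1,1)$-tensor field defined by $g(HX,Y)=K(X,Y)$, where $K=\mathcal L_\xi g-2\rho g$. $(M,\xi,\lambda,g)$ is an almost Ricci soliton if $\lambda$ is a smooth function on $M$ and $\frac12\mathcal L_{\xi}g+\operatorname{Ric}=\lambda g$. A vector field is closed if its $g$-dual $1$-form is closed. A vector field $\xi$ is conformal Killing if $\mathcal L_\xi g=2\sigma g$ for some smooth function $\sigma$ on $M$. $(M,g)$ is Einstein if $\operatorname{Ric}=\frac{r}{n}g$, with $r$ the scalar curvature. Integrals are with respect to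 the Riemannian measure. *)

(* Defs.v *)
From HB Require Import structures.
From mathcomp Require Import all_boot all_order all_algebra.
From mathcomp Require Import all_classical all_reals all_analysis.
Set Implicit Arguments.
Unset Strict Implicit.
Unset Printing Implicit Defensive.
Import Order.TTheory GRing.Theory Num.Theory.
Import numFieldNormedType.Exports.
Local Open Scope classical_set_scope.
Local Open Scope ring_scope.

(* MathComp-Analysis has no manifolds. A tensor field on a manifold is
   represented by its components in each chart (functions on R^n, relevant only
   on the image of the chart) obeying the usual transformation law. Tangent
   vectors are row vectors, so a linear map acts on the right. *)

Section Euclidean.
Context {R : realType} {n : nat}.
Local Notation E := 'rV[R]_n.

(* For U open, the directional derivatives of f on U depend only on f|U, and
   C^k is as usual: all iterated derivatives exist and are continuous. *)
Fixpoint Ck_on (k : nat) {F : normedModType R} (U : set E) (f : E -> F) : Prop :=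
  (forall x, U x -> {for x, continuous f}) /\
  match k with
  | 0 => True
  | k'.+1 => forall v : E,
      (forall x, U x -> derivable f x v) /\ Ck_on k' U ('D_v f)
  end.

Definition smooth_on {F : normedModType R} (U : set E) (f : E -> F) : Prop :=
  forall k, Ck_on k U f.

Definition basis (i : 'I_n) : E := delta_mx 0 i.

Definition form (A : 'M[R]_n) (u v : E) : R := (u *m A *m v^T) 0 0.

(* Below, G is the matrix of a metric in some chart, and X, Y, Z, xi are the
   components of vector fields in the same chart. *)
Implicit Types (G : E -> 'M[R]_n) (X Y Z xi : E -> E) (f : E -> R) (x : E).

Definition bracket X Y x : E := 'D_(X x) Y x - 'D_(Y x) X x.

Definition gradient G f x : E :=
  (\row_l 'D_(basis l) f x) *m invmx (G x).

(* Gamma^k_ij of the Levi-Civita connection *)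
Definition christoffel G x (i j k : 'I_n) : R :=
  2^-1 * \sum_l invmx (G x) k l *
    ('D_(basis i) (fun y => G y j l) x + 'D_(basis j) (fun y => G y i l) x
     - 'D_(basis l) (fun y => G y i j) x).

(* nabla_X Y *)
Definition cov G X Y x : E :=
  'D_(X x) Y x
  + \row_k \sum_i \sum_j christoffel G x i j k * X x 0 i * Y x 0 j.

Definition curvature G X Y Z x : E :=
  cov G X (cov G Y Z) x - cov G Y (cov G X Z) x - cov G (bracket X Y) Z x.

(* trace of X |-> R(X, Y)Z *)
Definition ricci G Y Z x : R :=
  \sum_i curvature G (fun=> basis i) Y Z x 0 i.

Definition scalar_curvature G x : R :=
  \sum_i \sum_j
    invmx (G x) i j * ricci G (fun=> basis i) (fun=> basis j) x.

(* (L_xi g)(X, Y) *)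
Definition lie_metric G xi X Y x : R :=
  'D_(xi x) (fun y => form (G y) (X y) (Y y)) x
  - form (G x) (bracket xi X x) (Y x) - form (G x) (X x) (bracket xi Y x).

(* (L_xi nabla)(X, Y) *)
Definition lie_connection G xi X Y x : E :=
  bracket xi (cov G X Y) x - cov G (bracket xi X) Y x
  - cov G X (bracket xi Y) x.

(* d eta (X, Y), where eta = g(xi, .) *)
Definition d_dual G xi X Y x : R :=
  'D_(X x) (fun y => form (G y) (xi y) (Y y)) x
  - 'D_(Y x) (fun y => form (G y) (xi y) (X y)) x
  - form (G x) (xi x) (bracket X Y x).

(* K = L_xi g - 2 f g *)
Definition tensorK G xi f X Y x : R :=
  lie_metric G xi X Y x - 2 * f x * form (G x) (X x) (Y x).

(* HX is X x *m tensorH G xi f x: g(HX, Y) = K(X, Y) means H *m G = (K_ij). *)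
Definition tensorH G xi f x : 'M[R]_n :=
  (\matrix_(i, j) tensorK G xi f (fun=> basis i) (fun=> basis j) x)
    *m invmx (G x).

End Euclidean.

(* The Lebesgue integral over R^n of a nonnegative Borel function, as an
   iterated integral (Tonelli). *)
Fixpoint iterated_integral {R : realType} (n : nat) :
    ('rV[R]_n -> \bar R) -> \bar R :=
  match n with
  | 0 => fun f => f 0
  | m.+1 => fun f =>
      (\int[lebesgue_measure]_(t in [set: R])
         @iterated_integral R m
           (fun v => f (row_mx (t%:M : 'rV[R]_1) v : 'rV[R]_m.+1)))%E
  end.

(* A smooth n-manifold without boundary on the space M, given by an atlas that
   need not be maximal. param i is the inverse of coord i; both are total
   functions, relevant only on chart_dom i and its image. *)
Record manifold (R : realType) (n : nat) (M : ptopologicalType) := Manifold {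
  chart : Type;
  chart_dom : chart -> set M;
  coord : chart -> M -> 'rV[R]_n;
  param : chart -> 'rV[R]_n -> M;
  chart_at : M -> chart;
  manifold_hausdorff : hausdorff_space M;
  manifold_countable : @second_countable M;
  chart_atP : forall p, chart_dom (chart_at p) p;
  chart_dom_open : forall i, open (chart_dom i);
  chart_img_open : forall i, open (coord i @` chart_dom i);
  coordK : forall i p, chart_dom i p -> param i (coord i p) = p;
  coord_continuous : forall i p, chart_dom i p ->
    {for p, continuous (coord i)};
  param_continuous : forall i p, chart_dom i p ->
    {for coord i p, continuous (param i)};
  transition_smooth : forall i j,
    smooth_on (coord i @` (chart_dom i `&` chart_dom j))
              (coord j \o param i)
}.

Section Manifold.
Context {R : realType} {n : nat} {M : ptopologicalType} (A : manifold R n M).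

Definition chart_img (i : chart A) : set 'rV[R]_n := coord i @` chart_dom i.

(* differential at p of the change of coordinates from chart i to chart j *)
Definition transition_diff (i j : chart A) (p : M) (u : 'rV[R]_n) : 'rV[R]_n :=
  'D_u (coord j \o param i) (coord i p).

Definition smooth (f : M -> R) : Prop :=
  forall i : chart A, smooth_on (chart_img i) (f \o param i : _ -> R^o).

Record vector_field := VectorField {
  vf_comp :> chart A -> 'rV[R]_n -> 'rV[R]_n;
  vf_smooth : forall i, smooth_on (chart_img i) (vf_comp i);
  vf_change : forall i j p, chart_dom i p -> chart_dom j p ->
    vf_comp j (coord j p) = transition_diff i j p (vf_comp i (coord i p))
}.

Record metric := Metric {
  metric_comp :> chart A -> 'rV[R]_n -> 'M[R]_n;
  metric_smooth : forall i, smooth_on (chart_img i) (metric_comp i);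
  metric_sym : forall i x, chart_img i x -> (metric_comp i x)^T = metric_comp i x;
  metric_pos : forall i x, chart_img i x ->
    forall u, u != 0 -> 0 < form (metric_comp i x) u u;
  metric_change : forall i j p, chart_dom i p -> chart_dom j p ->
    forall u v, form (metric_comp i (coord i p)) u v =
      form (metric_comp j (coord j p))
           (transition_diff i j p u) (transition_diff i j p v)
}.

Variable g : metric.
Implicit Types (xi X Y : vector_field) (f : M -> R).

Definition almost_ricci_soliton xi f : Prop :=
  smooth f /\
  forall X Y i x, chart_img i x ->
    2^-1 * lie_metric (g i) (xi i) (X i) (Y i) x + ricci (g i) (X i) (Y i) x
    = f (param i x) * form (g i x) (X i x) (Y i x).

Definition closed_field xi : Prop :=
  forall X Y i x, chart_img i x -> d_dual (g i) (xi i) (X i) (Y i) x = 0.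

Definition affine_conformal_killing xi f : Prop :=
  smooth f /\
  forall X Y i x, chart_img i x ->
    lie_connection (g i) (xi i) (X i) (Y i) x
    = 'D_(X i x) (f \o param i) x *: Y i x
      + 'D_(Y i x) (f \o param i) x *: X i x
      - form (g i x) (X i x) (Y i x) *: gradient (g i) (f \o param i) x.

Definition conformal_killing xi : Prop :=
  exists f, smooth f /\
  forall X Y i x, chart_img i x ->
    lie_metric (g i) (xi i) (X i) (Y i) x
    = 2 * f (param i x) * form (g i x) (X i x) (Y i x).

Definition einstein : Prop :=
  forall X Y i x, chart_img i x ->
    ricci (g i) (X i) (Y i) x
    = scalar_curvature (g i) x / n%:R * form (g i x) (X i x) (Y i x).

(* The next two scalars do not depend on the chart; they are computed in the
   chosen chart at p. *)
Definition ricci_at X Y (p : M) : R :=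
  let i := chart_at A p in ricci (g i) (X i) (Y i) (coord i p).

Definition traceH xi f (p : M) : R :=
  let i := chart_at A p in
  \tr (tensorH (g i) (xi i) (f \o param i) (coord i p)).

(* This determines the Borel measure mu, since M is a countable union of chart
   domains. *)
Definition riemannian_measure
    (mu : {measure set (g_sigma_algebraType (@open M)) -> \bar R}) : Prop :=
  forall i (B : set (g_sigma_algebraType (@open M))),
    measurable B -> B `<=` chart_dom i ->
    mu B = iterated_integral (fun x =>
      (\1_(coord i @` B) x * Num.sqrt (\det (g i x)))%:E).

End Manifold.

(* Main.v *)
From HB Require Import structures.
From mathcomp Require Import all_boot all_order all_algebra.
From mathcomp Require Import all_classical all_reals all_analysis.
From mathcomp Require Import ring lra.
Require Import Defs.
Set Implicit Arguments.
Unset Strict Implicit.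
Unset Printing Implicit Defensive.
Import Order.TTheory GRing.Theory Num.Theory.
Import numFieldNormedType.Exports.
Local Open Scope classical_set_scope.
Local Open Scope ring_scope.

(** Write P for the endomorphism X |-> nabla_X xi. As xi is closed, P is
    self-adjoint and L_xi g = 2 g(P -, -) ([lie_metricE]). So once P = f I for a
    smooth function f, the field xi is conformal Killing with factor f, the
    soliton equation reads Ric = (lambda - f) g, and tracing it identifies
    lambda - f with r / n. Everything rests on showing that P is scalar.

    The tensor (L_xi nabla)(X, Y) equals (nabla_X P) Y + R(xi, X) Y
    ([lie_connectionE]); the first term is self-adjoint in Y, the second one is
    skew. Splitting the affine conformal equation accordingly
    ([nabla_cov_mx_scalar]) gives
      nabla_X P = X(rho) I   and   R(xi, X) Y = Y(rho) X - g(X, Y) nabla rho.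
    By the first equation P - rho I, which is half of the tensor H, is parallel,
    so it commutes with the curvature operators; inserting the second equation,
    an endomorphism commuting with all R(xi, X) has to be scalar at each point
    where d rho does not vanish ([scalar_of_commute]).

    There are two cases. If d rho is nonzero at some point, the trace-free part N
    of P vanishes at that point. As N is parallel, tr (N^2) is constant on the
    connected manifold M, so N = 0 everywhere and P = (rho + c) I for a constant c
    ([concircular_nonconstant]). If d rho = 0 everywhere, then P itself is parallel.
    The function |xi|^2 / 2 has Hessian g(P -, P -) at its critical points; at a
    maximum, which exists because M is compact, the Hessian is also nonpositive,
    so P = 0 there ([energy_max]), and again everywhere because tr (P^2) is
    constant ([concircular_constant]).

    Tensors are given by components in charts, whereas the hypotheses speak of
    global fields. They are evaluated on fields that are constant near a point of
    a chart, built from bump functions ([vector_field_extension]); and the traces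
    above are functions on M because P is conjugated by the Jacobian of the
    transition map under a change of charts ([cov_mx_conj]). *)

(** * Derivatives along lines and continuously differentiable functions *)

Section Lines.
Context {R : realType} {V : normedModType R}.
Implicit Types (f : V -> R) (x v : V).

Lemma is_derive_line f x v t : derivable f (x + t *: v) v ->
  is_derive t (1 : R) (fun s => f (x + s *: v)) ('D_v f (x + t *: v)).
Proof.
move=> df.
have E : (fun h : R => h^-1 *: (f (h *: v + (x + t *: v)) - f (x + t *: v)))
       = (fun h : R => h^-1 *: (f (x + (h *: 1 + t) *: v) - f (x + t *: v))).
  apply/funext => h; rewrite [h *: 1]mulr1 scalerDl.
  by rewrite [h *: v + _]addrCA.
apply: DeriveDef.
  by move: df; rewrite /derivable E.
by rewrite /derive E.
Qed.

Lemma MVT_line_gt0 f x v (h : R) : 0 < h ->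
  (forall t, 0 <= t <= h -> derivable f (x + t *: v) v) ->
  exists2 c : R, 0 < c < h & f (x + h *: v) - f x = h * 'D_v f (x + c *: v).
Proof.
move=> h0 df.
have D t : 0 <= t <= h ->
    is_derive t (1 : R) (fun s => f (x + s *: v)) ('D_v f (x + t *: v)).
  by move=> th; apply: is_derive_line; exact: df.
have [t|/=|c] := @MVT R (fun s => f (x + s *: v)) (fun s => 'D_v f (x + s *: v)) 0 h h0.
- by rewrite in_itv/= => /andP[? ?]; apply: D; rewrite !ltW.
- apply: derivable_within_continuous => t.
  by rewrite in_itv/= => /D [].
- by rewrite in_itv/= scale0r addr0 subr0 mulrC => ch E; exists c.
Qed.

Lemma MVT_line f x v (h : R) :
  (forall t, `|t| <= `|h| -> derivable f (x + t *: v) v) ->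
  exists2 c : R, `|c| <= `|h| & f (x + h *: v) - f x = h * 'D_v f (x + c *: v).
Proof.
move=> df; have [h0|h0|->] := ltgtP h 0; last first.
- by exists 0; rewrite // !scale0r addr0 subrr mul0r.
- have [t /andP[t0 th]|c /andP[c0 ch] ->] := @MVT_line_gt0 f x v h h0.
    by apply: df; rewrite !ger0_norm// ltW.
  by exists c; rewrite // !gtr0_norm// ltW.
have hN0 : 0 < - h by rewrite oppr_gt0.
have shift t : x + h *: v + t *: v = x + (h + t) *: v by rewrite -addrA scalerDl.
have bound t : 0 <= t <= - h -> `|h + t| <= `|h|.
  by move=> /andP[t0 th]; rewrite (ltr0_norm h0) ler_norml; apply/andP; split; lra.
have [t /bound ht|c /andP[c0 ch]] := @MVT_line_gt0 f (x + h *: v) v (- h) hN0.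
  by rewrite shift; exact: df.
rewrite !shift subrr scale0r addr0 => E; exists (h + c); first by apply: bound; rewrite !ltW.
by rewrite -opprB E mulNr opprK.
Qed.

End Lines.

Lemma near_dist_le {R : realType} {V W : normedModType R} (f : V -> W) x (e : R) :
  {for x, continuous f} -> 0 < e -> \forall y \near x, `|f x - f y| <= e.
Proof. by move=> /pseudometric_normed_Zmodule.cvgrPdist_le; apply. Qed.

Section C1.
Context {R : realType} {n : nat}.
Local Notation E := 'rV[R]_n.
Implicit Types (f : E -> R) (x v : E).

Lemma rV_norm_coord (v : E) k : `|v 0 k| <= `|v|.
Proof.
rewrite [leRHS]/Num.Def.normr/= mx_normrE.
exact: (le_bigmax _ (fun ij : 'I_1 * 'I_n => `|v ij.1 ij.2|) (0, k)). Qed.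

Lemma rV_norm_le (v : E) (r : R) : 0 <= r -> (forall k, `|v 0 k| <= r) -> `|v| <= r.
Proof.
move=> r0 H; rewrite [leLHS]/Num.Def.normr/= mx_normrE; apply: bigmax_le => // -[i k] _ /=.
by rewrite (ord1 i).
Qed.

(** The path from 0 to v along the coordinate axes. *)
Definition rtrunc (v : E) (k : nat) : E := \row_j (if (j < k)%N then v 0 j else 0).

Lemma rtrunc0 v : rtrunc v 0 = 0.
Proof. by apply/rowP => j; rewrite !mxE. Qed.
Lemma rtruncn v : rtrunc v n = v.
Proof. by apply/rowP => j; rewrite !mxE ltn_ord. Qed.
Lemma rtruncS v (k : 'I_n) : rtrunc v k.+1 = rtrunc v k + v 0 k *: basis k.
Proof.
apply/rowP => j; rewrite !mxE eqxx/= ltnS leq_eqVlt.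
have [->|jk] := eqVneq j k; first by rewrite eqxx ltnn/= mulr1 add0r.
by rewrite (_ : (j == k :> nat) = false)/= ?mulr0 ?addr0//; apply/negbTE.
Qed.

Lemma norm_rtrunc_add v (k : 'I_n) (c : R) : `|c| <= `|v 0 k| ->
  `|rtrunc v k + c *: basis k| <= `|v|.
Proof.
move=> cv; apply: rV_norm_le => // j; rewrite !mxE eqxx/=.
have [->|jk] := eqVneq j k.
  by rewrite ltnn mulr1 add0r (le_trans cv)// rV_norm_coord.
by rewrite mulr0 addr0; case: ifP => _; rewrite ?normr0// rV_norm_coord.
Qed.

Definition linear_increment f x (v : E) : R := \sum_k v 0 k * 'D_(basis k) f x.

(** Moving from x to x + v one coordinate at a time and applying the mean value
    theorem to each step compares the increment of f with its linear part. *)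
Lemma C1_increment f x (e : R) : 0 < e ->
  (\forall y \near x, forall k, derivable f y (basis k)) ->
  (forall k, {for x, continuous ('D_(basis k) f)}) ->
  \forall v \near (0 : E), `|f (v + x) - (f x + linear_increment f x v)| <= e * `|v|.
Proof.
move=> e0 df cf.
pose e' := e / (n.+1)%:R.
have e'0 : 0 < e' by rewrite divr_gt0.
have : \forall y \near x, forall k, derivable f y (basis k) /\
    `|'D_(basis k) f x - 'D_(basis k) f y| <= e'.
  have cf' : \forall y \near x, forall k : 'I_n, `|'D_(basis k) f x - 'D_(basis k) f y| <= e'.
    have := @filter_forall E 'I_n
      (fun k y => `|'D_(basis k) f x - 'D_(basis k) f y| <= e') (nbhs x) _.
    by apply=> k; exact: (@near_dist_le R E R _ _ _ (cf k) e'0).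
  by apply: filterS2 df cf' => y d1 d2 k; split.
move=> /nbhs_ballP[r/= r0 Hr].
near=> v.
have vr : `|v| < r by near: v; exact: (@nbhs0_lt R E r r0).
have B (w : E) : `|w| <= `|v| -> ball x r (x + w).
  by move=> wv; rewrite -ball_normE/= opprD addrA subrr sub0r normrN (le_lt_trans wv).
have step (k : 'I_n) : `|f (x + rtrunc v k.+1) - f (x + rtrunc v k) - v 0 k * 'D_(basis k) f x|
    <= e' * `|v|.
  rewrite rtruncS addrA.
  have [t tv|c cv ->] := @MVT_line R _ f (x + rtrunc v k) (basis k) (v 0 k).
    by rewrite -addrA; apply: (Hr _ (B _ _) k).1; exact: norm_rtrunc_add.
  rewrite -mulrBr normrM mulrC ler_pM ?rV_norm_coord// distrC -addrA.
  by apply: (Hr _ (B _ _) k).2; exact: norm_rtrunc_add.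
have tele : f (x + v) - f x = \sum_(k < n) (f (x + rtrunc v k.+1) - f (x + rtrunc v k)).
  rewrite -(big_mkord xpredT (fun k => f (x + rtrunc v k.+1) - f (x + rtrunc v k))).
  by rewrite telescope_sumr// rtruncn rtrunc0 addr0.
rewrite [v + x]addrC opprD addrA tele /linear_increment -sumrB.
apply: (le_trans (ler_norm_sum _ _ _)).
apply: (@le_trans _ _ (\sum_(k < n) (e' * `|v|))).
  by apply: ler_sum => k _; exact: step.
rewrite sumr_const card_ord -mulrnAl ler_wpM2r// /e' -mulr_natr -mulrA ler_piMr ?(ltW e0)//.
by rewrite mulrC ler_pdivrMr// mul1r ler_nat.
Unshelve. all: by end_near. Qed.

Lemma linear_increment_linear f x : linear (linear_increment f x).
Proof.
move=> a u v; rewrite /linear_increment scaler_sumr -big_split/=; apply: eq_bigr => k _.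
by rewrite !mxE mulrDl scalerAl.
Qed.

Lemma C1_differentiable f x :
  (\forall y \near x, forall k, derivable f y (basis k)) ->
  (forall k, {for x, continuous ('D_(basis k) f)}) ->
  differentiable f x.
Proof.
move=> df cf.
pose L : {linear E -> R^o} := HB.pack (linear_increment f x : E -> R^o)
  (GRing.isLinear.Build R E R^o *:%R (linear_increment f x) (linear_increment_linear f x)).
have Lc : continuous L.
  apply: (@continuous_big R^o) => [|k _ v]; first exact: add_continuous.
  apply: (@continuousM R E (fun v : E => v 0 k) (cst ('D_(basis k) f x)) v).
    exact: matrix_normedtype.coord_continuous.
  exact: cst_continuous.
have dE := @diff_unique R E R f L x Lc.
match type of dE with ?o -> _ => have oo : o end.
  apply/eqaddoP => e e0; near do rewrite /= !fctE /=.
  exact: C1_increment.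
apply/diff_locallyP; rewrite (dE oo); split; [exact: Lc|exact: oo].
Unshelve. all: by end_near. Qed.
End C1.

(** * Calculus of C^k functions *)

Section CkBasics.
Context {R : realType} {n : nat} {F : normedModType R}.
Local Notation E := 'rV[R]_n.
Implicit Types (f g : E -> F) (U V : set E).

Lemma Ck_continuous k U f x : Ck_on k U f -> U x -> {for x, continuous f}.
Proof. by case: k => [|k] [+ _]; apply. Qed.

Lemma Ck_derivable k U f x v : Ck_on k.+1 U f -> U x -> derivable f x v.
Proof. by move=> [_ /(_ v)[+ _]]; apply. Qed.

Lemma Ck_derive k U f v : Ck_on k.+1 U f -> Ck_on k U ('D_v f).
Proof. by move=> [_ /(_ v)[_]]. Qed.

Lemma CkS k U f : Ck_on k.+1 U f -> Ck_on k U f.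
Proof.
elim: k f => [|k IH] f /=; first by case.
by case=> cf df; split=> // v; have [dv /IH] := df v.
Qed.

Lemma Ck_subset k U V f : V `<=` U -> Ck_on k U f -> Ck_on k V f.
Proof.
move=> VU; elim: k f => [|k IH] f /= [cf df]; split; do ?by move=> x /VU /cf.
- by [].
by move=> v; have [d1 d2] := df v; split=> [x /VU/d1|]//; exact: IH.
Qed.

(** All the conditions in [Ck_on] are pointwise in the point of the open set. *)
Lemma Ck_local k U f :
  (forall x, U x -> exists2 V, V x & Ck_on k V f) -> Ck_on k U f.
Proof.
elim: k f => [|k IH] f H.
  by split=> // x /H[V Vx /Ck_continuous]; apply.
split=> [x /H[V Vx /Ck_continuous]|v]; first exact.
split=> [x /H[V Vx /Ck_derivable]|]; first exact.
by apply: IH => x /H[V Vx Cf]; exists V => //; exact: Ck_derive.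
Qed.

Lemma open_near (U : set E) (x : E) : open U -> U x -> \forall y \near x, U y.
Proof. by move=> oU Ux; exact: open_nbhs_nbhs. Qed.

Lemma Ck_eq k U f g : open U -> (forall x, U x -> f x = g x) ->
  Ck_on k U f -> Ck_on k U g.
Proof.
move=> oU; elim: k f g => [|k IH] f g fg.
  case=> cf _; split=> // x Ux.
  have nfg : {near x, f =1 g} by near=> y; apply: fg; near: y; exact: open_near.
  rewrite /prop_for /continuous_at -(fg _ Ux); apply: cvg_trans (cf x Ux).
  exact: (near_eq_cvg nfg).
have nfg x : U x -> {near x, f =1 g}.
  by move=> Ux; near=> y; apply: fg; near: y; exact: open_near.
move=> Cf; split=> [x Ux|v].
  rewrite /prop_for /continuous_at -(fg _ Ux); apply: cvg_trans (Ck_continuous Cf Ux).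
  exact: (near_eq_cvg (nfg _ Ux)).
split=> [x Ux|].
  apply: (near_eq_derivable (nfg x Ux)); exact: (Ck_derivable Cf Ux).
apply: IH (Ck_derive v Cf) => x Ux.
exact: (near_eq_derive v (nfg x Ux)).
Unshelve. all: by end_near. Qed.

Lemma Ck_cst k U (c : F) : Ck_on k U (fun=> c).
Proof.
elim: k c => [|k IH] c; split=> //; do ?by move=> x _; exact: cst_continuous.
move=> v; split=> [x _|]; first exact: derivable_cst.
by rewrite (_ : 'D_v _ = fun=> 0)//; apply/funext => x; exact: derive_cst.
Qed.

Lemma Ck_add k U f g : open U -> Ck_on k U f -> Ck_on k U g ->
  Ck_on k U (fun x => f x + g x).
Proof.
move=> oU; elim: k f g => [|k IH] f g Cf Cg; split=> //;
  do ?by move=> x Ux; apply: continuousD; apply: Ck_continuous Ux; eassumption.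
move=> v; split=> [x Ux|].
  by apply: derivableD; apply: Ck_derivable Ux; eassumption.
apply: Ck_eq (IH _ _ (Ck_derive v Cf) (Ck_derive v Cg)) => // x Ux /=.
by rewrite [RHS]deriveD//; apply: Ck_derivable Ux; eassumption.
Qed.

Lemma Ck_opp k U f : open U -> Ck_on k U f -> Ck_on k U (fun x => - f x).
Proof.
move=> oU; elim: k f => [|k IH] f Cf; split=> //;
  do ?by move=> x Ux; apply: continuousN; apply: Ck_continuous Ux; eassumption.
move=> v; split=> [x Ux|].
  by apply: derivableN; apply: Ck_derivable Ux; eassumption.
apply: Ck_eq (IH _ (Ck_derive v Cf)) => // x Ux /=.
by rewrite [RHS]deriveN//; apply: Ck_derivable Ux; eassumption.
Qed.

Lemma Ck_sum k U (I : Type) (r : seq I) (P : pred I) (f : I -> E -> F) : open U ->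
  (forall i, P i -> Ck_on k U (f i)) -> Ck_on k U (fun x => \sum_(i <- r | P i) f i x).
Proof.
move=> oU H; elim: r => [|i r IH].
  by apply: Ck_eq (Ck_cst k U 0) => // x _; rewrite big_nil.
have [Pi|/negbTE Pi] := boolP (P i).
  by apply: Ck_eq (Ck_add oU (H _ Pi) IH) => // x _; rewrite big_cons Pi.
by apply: Ck_eq IH => // x _; rewrite big_cons Pi.
Qed.

End CkBasics.

Section CkScalar.
Context {R : realType} {n : nat}.
Local Notation E := 'rV[R]_n.
Implicit Types (f g : E -> R) (U V : set E).

Lemma Ck_mul k U f g : open U -> Ck_on k U f -> Ck_on k U g ->
  Ck_on k U (fun x => f x * g x).
Proof.
move=> oU; elim: k f g => [|k IH] f g Cf Cg; split=> //;
  do ?by move=> x Ux; apply: continuousM; apply: Ck_continuous Ux; eassumption.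
move=> v; split=> [x Ux|].
  by apply: derivableM; apply: Ck_derivable Ux; eassumption.
apply: Ck_eq (Ck_add oU (IH _ _ (CkS Cf) (Ck_derive v Cg))
                        (IH _ _ (CkS Cg) (Ck_derive v Cf))) => // x Ux /=.
by rewrite [RHS]deriveM//; apply: Ck_derivable Ux; eassumption.
Qed.

Lemma Ck_prod k U (I : Type) (r : seq I) (P : pred I) (f : I -> E -> R) : open U ->
  (forall i, P i -> Ck_on k U (f i)) -> Ck_on k U (fun x => \prod_(i <- r | P i) f i x).
Proof.
move=> oU H; elim: r => [|i r IH].
  by apply: (Ck_eq oU _ (@Ck_cst R n R k U 1)) => // x _; rewrite big_nil.
have [Pi|/negbTE Pi] := boolP (P i).
  by apply: Ck_eq (Ck_mul oU (H _ Pi) IH) => // x _; rewrite big_cons Pi.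
by apply: Ck_eq IH => // x _; rewrite big_cons Pi.
Qed.

Lemma Ck_coord k U (j : 'I_n) : Ck_on k U (fun x => x 0 j).
Proof.
case: k => [|k].
  by split=> // x _; exact: matrix_normedtype.coord_continuous.
have D (x v : E) : is_derive x v (fun x : E => x 0 j) (v 0 j).
  have dc := @differentiable_coord R 1 n x 0 j.
  apply: DeriveDef; first exact: diff_derivable.
  have := @derive_mx R E 1 n id x v (@derivable_id _ _ _ _).
  by rewrite derive_id => /matrixP/(_ 0 j); rewrite mxE.
split=> [x _|v]; first exact: matrix_normedtype.coord_continuous.
split=> [x _|]; first by have [] := D x v.
rewrite (_ : 'D_v _ = fun=> v 0 j); first exact: Ck_cst.
by apply/funext => x; have [] := D x v.
Qed.

Lemma Ck_differentiable k U f x : open U -> Ck_on k.+1 U f -> U x ->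
  differentiable f x.
Proof.
move=> oU Cf Ux; apply: C1_differentiable.
  by near=> y => i; apply: (Ck_derivable Cf); near: y; exact: open_near.
by move=> i; exact: Ck_continuous (Ck_derive _ Cf) Ux.
Unshelve. all: by end_near. Qed.

(** This is the linearity of v |-> 'D_v f x, which holds because f is Frechet
    differentiable. *)
Lemma derive_lin f (x v : E) : differentiable f x ->
  'D_v f x = \sum_k v 0 k * 'D_(basis k) f x.
Proof.
move=> df; rewrite deriveE// {1}(row_sum_delta v) linear_sum/=.
by apply: eq_bigr => k _; rewrite linearZ/= deriveE.
Qed.

End CkScalar.

(** * Chain rule, composition, symmetry of second derivatives *)

Section Chain.
Context {R : realType}.

Lemma derive_comp (U V W : normedModType R) (t : U -> V) (f : V -> W) (x v : U) :
  differentiable t x -> differentiable f (t x) ->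
  'D_v (f \o t) x = 'D_('D_v t x) f (t x).
Proof.
move=> dt df; rewrite !deriveE//; last exact: differentiable_comp.
by rewrite diff_comp.
Qed.

Lemma differentiable_mx (V : normedModType R) m n (f : V -> 'M[R]_(m, n)) x :
  (forall i j, differentiable (fun y => f y i j) x) -> differentiable f x.
Proof.
move=> df.
have -> : f = \sum_i \sum_j (fun y => f y i j *: delta_mx i j).
  apply/funext => y; rewrite {1}(matrix_sum_delta (f y)) fct_sumE.
  by apply: eq_bigr => i _; rewrite fct_sumE.
apply: differentiable_sum => i; apply: differentiable_sum => j.
exact: differentiableZl.
Qed.

Lemma Ck_mxP n p q k (U : set 'rV[R]_n) (f : 'rV[R]_n -> 'M[R]_(p, q)) :
  open U -> Ck_on k U f <-> forall i j, Ck_on k U (fun x => f x i j).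
Proof.
move=> oU; elim: k f => [|k IH] f; split.
- move=> [cf _] i j; split=> // x Ux.
  apply: (@continuous_comp _ _ _ f (fun A : 'M[R]_(p, q) => A i j)); first exact: cf.
  exact: matrix_normedtype.coord_continuous.
- move=> H; split=> // x Ux; apply/(@pseudometric_normed_Zmodule.cvgrPdist_le R 'M[R]_(p, q) _ (nbhs x) _ f (f x)) => e e0.
  have K := @filter_forall _ _ (fun (ij : 'I_p * 'I_q) y =>
    `|f x ij.1 ij.2 - f y ij.1 ij.2| <= e) (nbhs x) _.
  have {}K : \forall y \near x, forall ij : 'I_p * 'I_q,
      `|f x ij.1 ij.2 - f y ij.1 ij.2| <= e.
    by apply: K => -[i j]; have /cvgrPdist_le := (H i j).1 x Ux; apply.
  apply: filterS K => y K.
  rewrite [leLHS]/Num.Def.normr/= mx_normrE (bigmax_le _ (ltW e0))//= => ij _.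
  by rewrite !mxE; exact: K.
- move=> Cf i j; split=> [x Ux|v].
    apply: (@continuous_comp _ _ _ f (fun A : 'M[R]_(p, q) => A i j)).
      exact: Ck_continuous Cf Ux.
    exact: matrix_normedtype.coord_continuous.
  split=> [x Ux|].
    by have /derivable_mxP := Ck_derivable (v := v) Cf Ux; apply.
  have /IH/(_ i j) := Ck_derive v Cf; apply: Ck_eq => // x Ux.
  by rewrite derive_mx ?mxE//; exact: Ck_derivable Cf Ux.
- move=> H; have H0 : Ck_on k U f by apply/IH => i j; exact: CkS.
  have D x v : U x -> derivable f x v.
    by move=> Ux; apply/derivable_mxP => i j; exact: Ck_derivable (H i j) Ux.
  split=> [x Ux|v]; first exact: Ck_continuous H0 Ux.
  split=> [x Ux|]; first exact: D.
  apply/IH => i j; apply: Ck_eq (Ck_derive v (H i j)) => // x Ux.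
  by rewrite derive_mx ?mxE//; exact: D.
Qed.

Lemma Ck_mx_differentiable n p q k (U : set 'rV[R]_n) (f : 'rV[R]_n -> 'M[R]_(p, q)) x :
  open U -> Ck_on k.+1 U f -> U x -> differentiable f x.
Proof.
move=> oU Cf Ux; apply: differentiable_mx => i j.
by apply: (Ck_differentiable oU _ Ux); move/(Ck_mxP _ _ oU): Cf; apply.
Qed.

Lemma Ck_comp m n k (U : set 'rV[R]_m) (V : set 'rV[R]_n) (t : 'rV[R]_m -> 'rV[R]_n)
    (f : 'rV[R]_n -> R) : open U -> open V -> (forall x, U x -> V (t x)) ->
  Ck_on k U t -> Ck_on k V f -> Ck_on k U (f \o t).
Proof.
move=> oU oV UV; elim: k t f UV => [|k IH] t f UV Ct Cf.
  split=> // x Ux; apply: continuous_comp; first exact: Ck_continuous Ct Ux.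
  by apply: (Ck_continuous Cf); exact: UV.
have dt x : U x -> differentiable t x by move=> Ux; exact: (Ck_mx_differentiable oU Ct).
have df x : U x -> differentiable f (t x).
  by move=> Ux; apply: (Ck_differentiable oV Cf); exact: UV.
split=> [x Ux|v].
  apply: continuous_comp; first exact: Ck_continuous Ct Ux.
  by apply: (Ck_continuous Cf); exact: UV.
split=> [x Ux|].
  apply: diff_derivable; apply: differentiable_comp; [exact: dt|exact: df].
have H : Ck_on k U (fun x => \sum_l 'D_v t x 0 l * ('D_(basis l) f \o t) x).
  apply: Ck_sum => // l _; apply: Ck_mul => //.
    by have /(Ck_mxP _ _ oU) := Ck_derive v Ct; apply.
  by apply: IH => //; [exact: CkS|exact: Ck_derive].
apply: Ck_eq H => // x Ux; rewrite (@derive_comp _ _ _ t f x v (dt x Ux) (df x Ux)).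
by rewrite derive_lin; last exact: df.
Qed.

Lemma Ck_inv n k (U : set 'rV[R]_n) (f : 'rV[R]_n -> R) : open U ->
  (forall x, U x -> f x != 0) -> Ck_on k U f -> Ck_on k U (fun x => (f x)^-1).
Proof.
move=> oU f0; elim: k => [|k IH] Cf.
  by split=> // x Ux; apply: continuousV; [exact: f0|exact: Ck_continuous Cf Ux].
split=> [x Ux|v].
  by apply: continuousV; [exact: f0|exact: Ck_continuous Cf Ux].
split=> [x Ux|].
  by apply: derivableV; [exact: f0|exact: Ck_derivable Cf Ux].
have I := IH (CkS Cf).
apply: Ck_eq (Ck_opp oU (Ck_mul oU (Ck_mul oU I I) (Ck_derive v Cf))) => // x Ux.
rewrite [RHS]deriveV; [|exact: f0|exact: Ck_derivable Cf Ux].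
by rewrite /GRing.scale/= mulNr -exprVn expr2.
Qed.

(** For a family of functions of one variable whose derivatives stay in the span
    of the family; all members are then smooth. *)
Lemma Ck_family n k (U : set 'rV[R]_n) (u : 'rV[R]_n -> R) (Phi : nat -> R -> R)
    (a b : nat -> R) (i : nat) : open U ->
  (forall m (t : R), is_derive t (1 : R) (Phi m) (a m * Phi m.+1 t + b m * Phi m.+2 t)) ->
  Ck_on k U u -> Ck_on k U (Phi i \o u).
Proof.
move=> oU dPhi; elim: k i => [|k IH] i Cu.
  split=> // x Ux; apply: continuous_comp; first exact: Ck_continuous Cu Ux.
  by apply: differentiable_continuous; apply/derivable1_diffP; case: (dPhi i (u x)).
have dP x : differentiable (Phi i) (u x).
  by apply/derivable1_diffP; case: (dPhi i (u x)).
have du x : U x -> differentiable u x by move=> Ux; exact: (Ck_differentiable oU Cu).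
split=> [x Ux|v].
  apply: continuous_comp; first exact: Ck_continuous Cu Ux.
  exact: differentiable_continuous.
split=> [x Ux|].
  by apply: diff_derivable; apply: differentiable_comp; [exact: du|exact: dP].
have C j : Ck_on k U (Phi j \o u) by apply: IH; exact: CkS.
have H : Ck_on k U (fun x => 'D_v u x * (a i * (Phi i.+1 \o u) x + b i * (Phi i.+2 \o u) x)).
  apply: Ck_mul => //; first exact: Ck_derive.
  by apply: Ck_add => //; apply: Ck_mul => //; exact: (@Ck_cst R n R).
apply: Ck_eq H => // x Ux /=.
rewrite (@derive_comp _ _ _ u (Phi i) x v (du x Ux) (dP x)).
have -> : 'D_('D_v u x) (Phi i) (u x) = 'D_v u x * 'D_1 (Phi i) (u x).
  rewrite -[X in 'D_X _ _ = _]mulr1 -[_ * 1]/(_ *: _).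
  by rewrite !(deriveE _ (dP x)) linearZ.
by have [_ ->] := dPhi i (u x).
Qed.

End Chain.

Section Schwarz.
Context {R : realType} {n : nat}.
Local Notation E := 'rV[R]_n.

Lemma derive_translate (F : normedModType R) (f : E -> F) (a y v : E) :
  'D_v (fun z => f (z + a)) y = 'D_v f (y + a) /\
  (derivable f (y + a) v -> derivable (fun z => f (z + a)) y v).
Proof.
have E : (fun h : R => h^-1 *: (f (h *: v + (y + a)) - f (y + a)))
       = (fun h : R => h^-1 *: (((fun z => f (z + a)) \o shift y) (h *: v) - f (y + a))).
  by apply/funext => h /=; rewrite addrA.
by split; rewrite /derive /derivable -?E.
Qed.

(** The mixed second difference of f, evaluated by two applications of the mean
    value theorem: the difference in the direction v of the difference in the
    direction u. Exchanging u and v gives the other mixed derivative. *)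
Lemma double_difference (f : E -> R) (U : set E) (x u v : E) (s : R) :
  open U -> Ck_on 2 U f ->
  (forall a b : R, `|a| <= `|s| -> `|b| <= `|s| -> U (x + a *: u + b *: v)) ->
  exists a b : R, [/\ `|a| <= `|s|, `|b| <= `|s| &
    f (x + s *: u + s *: v) - f (x + s *: v) - (f (x + s *: u) - f x)
    = s * (s * 'D_u ('D_v f) (x + a *: u + b *: v))].
Proof.
move=> oU Cf H.
pose g y := f (y + s *: u) - f y.
have s0 : `|0 : R| <= `|s| by rewrite normr0.
have Du t : `|t| <= `|s| -> derivable (fun y => f (y + s *: u)) (x + t *: v) v.
  move=> ts; apply: (derive_translate _ _ _ _).2; apply: (Ck_derivable Cf).
  by rewrite addrAC; exact: H.
have D0 t : `|t| <= `|s| -> derivable f (x + t *: v) v.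
  by move=> ts; apply: (Ck_derivable Cf); have := H _ _ s0 ts; rewrite scale0r addr0.
have [t ts|b bs] := @MVT_line R _ g x v s.
  by apply: derivableB; [exact: Du|exact: D0].
rewrite {1 2}/g [_ + _ + s *: u]addrAC => ->.
rewrite deriveB; [|exact: Du|exact: D0]; rewrite (derive_translate _ _ _ _).1.
have [t ts|a as_ ->] := @MVT_line R _ ('D_v f) (x + b *: v) u s.
  by apply: (Ck_derivable (Ck_derive v Cf)); rewrite addrAC; exact: H.
by exists a, b; rewrite as_ bs [x + b *: v + _]addrAC.
Qed.

Lemma dist_third_absurd (w z p q : R) : 0 < `|w - z| -> p = q ->
  `|w - p| <= `|w - z| / 3 -> `|z - q| <= `|w - z| / 3 -> False.
Proof.
move=> wz0 -> Aq Bq.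
have := ler_distD q w z; rewrite (distrC q z).
by move: Aq Bq wz0; lra.
Qed.

Lemma Schwarz (f : E -> R) (U : set E) (x u v : E) :
  open U -> U x -> Ck_on 2 U f -> 'D_u ('D_v f) x = 'D_v ('D_u f) x.
Proof.
move=> oU Ux Cf; apply/eqP; rewrite -subr_eq0 -normr_eq0.
apply/negP => /negP; rewrite normr_eq0 -normr_gt0.
set d := `|_| => d0.
have d30 : 0 < d / 3 by rewrite divr_gt0.
have c1 : {for x, continuous ('D_u ('D_v f))}.
  by exact: (Ck_continuous (Ck_derive _ (Ck_derive _ Cf)) Ux).
have c2 : {for x, continuous ('D_v ('D_u f))}.
  by exact: (Ck_continuous (Ck_derive _ (Ck_derive _ Cf)) Ux).
have [r/= r0 Hr] : exists2 r : R, 0 < r & forall y, `|y - x| < r -> [/\ U y,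
    `|'D_u ('D_v f) x - 'D_u ('D_v f) y| <= d / 3 &
    `|'D_v ('D_u f) x - 'D_v ('D_u f) y| <= d / 3].
  have /nbhs_ballP[r1 /= r10 B1] := @near_dist_le R E R _ _ _ c1 d30.
  have /nbhs_ballP[r2 /= r20 B2] := @near_dist_le R E R _ _ _ c2 d30.
  have /nbhs_ballP[r3 /= r30 B3] := open_near oU Ux.
  exists (Num.min r3 (Num.min r1 r2)); first by rewrite !lt_min r10 r20 r30.
  move=> y; rewrite !lt_min distrC => /and3P[y3 y1 y2].
  split; [apply: B3|apply: B1|apply: B2]; by rewrite -ball_normE.
(* With this s, the points x + a u + b v stay in the ball of radius r as long as
   |a| and |b| are at most s. *)
pose K := `|u| + `|v| + 1.
have K0 : 0 < K by rewrite ltr_pwDr// addr_ge0.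
pose s := r / 2 / K.
have s0 : 0 < s by rewrite !divr_gt0.
have B (a b : R) : `|a| <= `|s| -> `|b| <= `|s| -> `|x + a *: u + b *: v - x| < r.
  move=> as_ bs; rewrite -[x + _ + _]addrA [x + _]addrC addrK.
  apply: le_lt_trans (ler_normD _ _) _; rewrite !normrZ.
  apply: (@le_lt_trans _ _ (s * K)).
    rewrite /K mulrDr mulr1 mulrDr -[leLHS]addr0 lerD ?(ltW s0)//.
    by rewrite lerD// ler_wpM2r// -(gtr0_norm s0).
  by rewrite /s divfK ?gt_eqF// ltr_pdivrMr// mulr_natr mulr2n ltrDl.
have [a [b [as_ bs E1]]] := double_difference oU Cf (fun a b as_ bs => let: And3 h _ _ := Hr _ (B a b as_ bs) in h).
have B' (a' b' : R) : `|a'| <= `|s| -> `|b'| <= `|s| -> U (x + a' *: v + b' *: u).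
  by move=> h1 h2; rewrite addrAC; have [] := Hr _ (B _ _ h2 h1).
have [a' [b' [as' bs' E2]]] := double_difference oU Cf B'.
have : s * (s * 'D_u ('D_v f) (x + a *: u + b *: v)) =
       s * (s * 'D_v ('D_u f) (x + a' *: v + b' *: u)).
  apply: (etrans (esym E1)); apply: (etrans _ E2).
  (* Both double differences are the alternating sum over the same parallelogram. *)
  have swap (p q r' t : R) : p - q - (r' - t) = p - r' - (q - t) by ring.
  by rewrite (addrAC x (s *: u)); exact: swap.
move=> /(mulfI (lt0r_neq0 s0))/(mulfI (lt0r_neq0 s0)) E.
have [_ N1 _] := Hr _ (B _ _ as_ bs).
have [_ _ N2] := Hr _ (B _ _ bs' as').
rewrite (addrAC x (b' *: u)) in N2.
exact: (dist_third_absurd d0 E N1 N2).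
Qed.

End Schwarz.

(** * Bump functions *)

Section Flat.
Context {R : realType}.

Definition flat (m : nat) (t : R) : R :=
  if 0 < t then t^-1 ^+ m * expR (- t^-1) else 0.

Lemma flat_ge0 m t : 0 <= flat m t.
Proof. by rewrite /flat; case: ifPn => // t0; rewrite mulr_ge0 ?expR_ge0// exprn_ge0// invr_ge0 ltW. Qed.

Lemma flat0_gt0 t : (0 < flat 0 t) = (0 < t).
Proof. by rewrite /flat; case: ifP => _; rewrite ?ltxx// expr0 mul1r expR_gt0. Qed.

(** The exponential grows faster than any power; the factor |t| makes every
    [flat m] continuous at 0, hence also differentiable there, since
    [flat m t = t * flat m.+1 t]. *)
Lemma flat_le m t : flat m t <= (m.+1)`!%:R * `|t|.
Proof.
rewrite /flat; case: ifPn => [t0|_]; last by rewrite mulr_ge0.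
rewrite (gtr0_norm t0) expRN ler_pdivrMr ?expR_gt0//.
have s0 : 0 <= t^-1 by rewrite invr_ge0 ltW.
have fact0 : 0 < (m.+1)`!%:R :> R by rewrite ltr0n fact_gt0.
have H : t^-1 ^+ m.+1 / (m.+1)`!%:R <= expR t^-1.
  by apply: le_trans (expR_ge1Dxn m s0); rewrite lerDr.
rewrite -ler_pdivrMl ?mulr_gt0//; apply: le_trans H.
by rewrite le_eqVlt; apply/orP; left; apply/eqP; rewrite invfM exprSr; ring.
Qed.

Lemma flat_cvg0 m : {for 0, continuous (flat m)}.
Proof.
have f0 : flat m 0 = 0 by rewrite /flat ltxx.
rewrite /prop_for /continuous_at f0.
apply/(@pseudometric_normed_Zmodule.cvgrPdist_le R R) => e e0.
have C0 : 0 < e / (m.+1)`!%:R by rewrite divr_gt0// ltr0n fact_gt0.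
have := @nbhs0_le R R _ C0; apply: filterS => t tC.
rewrite sub0r normrN ger0_norm ?flat_ge0//.
by apply: (le_trans (flat_le _ _)); rewrite mulrC -ler_pdivlMr ?ltr0n ?fact_gt0.
Qed.

Lemma is_derive_flat m (t : R) :
  is_derive t (1 : R) (flat m) (- m%:R * flat m.+1 t + 1 * flat m.+2 t).
Proof.
have [t0|t0|<-] := ltgtP 0 t.
- have tN0 : t != 0 by rewrite gt_eqF.
  have dV : is_derive t (1 : R) (fun y : R => y^-1) (- t ^- 2).
    have := @is_deriveV R id t 1 1 tN0 (@is_derive_id R R t 1).
    by rewrite /GRing.scale/= mulr1.
  have dE : is_derive t (1 : R) (expR \o (fun y : R => - y^-1)) (expR (- t^-1) * - - t ^- 2).
    by apply: is_derive1_comp; exact: is_deriveN.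
  have dX := @is_deriveX R R _ m _ _ _ dV.
  rewrite [X in is_derive _ _ X _]exprfctE in dX.
  have dM := @is_deriveM R R _ _ _ _ _ _ dX dE.
  have -> : - m%:R * flat m.+1 t + 1 * flat m.+2 t = 
    (fun y : R => y^-1) t ^+ m *: (expR (- t^-1) * - - t ^- 2) +
      (expR \o (fun y : R => - y^-1)) t *: (m%:R * t^-1 ^+ m.-1 *: - t ^- 2).
    rewrite /flat t0 /GRing.scale/= -exprVn.
    by case: (m) => [|k]/=; rewrite ?mul0r ?mulr0n !exprS; ring.
  apply: (@near_eq_is_derive R R R _ _ _ _ _ _ dM); near=> y.
  by rewrite /flat ifT//; near: y; exact: (@lt_nbhsr R 0 t t0).
- rewrite /flat !ltNge (ltW t0)/= !mulr0 addr0.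
  apply: (@near_eq_is_derive R R R (cst 0)) => //.
  near=> y; rewrite /= ifF//; apply/negbTE; rewrite -leNgt ltW//.
  by near: y; exact: (@lt_nbhsl R t 0 t0).
- apply/is_derive1_caratheodory; exists (flat m.+1); split.
  + move=> z; rewrite {2}/flat ltxx !subr0 /flat.
    by case: ifPn => z0; rewrite ?mul0r// exprSr mulrAC -[_ * _ * z]mulrA mulVf ?mulr1// gt_eqF.
  + exact: flat_cvg0.
  + by rewrite /flat !ltxx !mulr0 addr0.
Unshelve. all: by end_near. Qed.
End Flat.

Section Bump.
Context {R : realType} {n : nat}.
Local Notation E := 'rV[R]_n.

Definition sqdist (a y : E) : R := \sum_k (y 0 k - a 0 k) ^+ 2.

Lemma Ck_sqdist a k (U : set E) : open U -> Ck_on k U (sqdist a).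
Proof.
move=> oU; apply: Ck_sum => // j _.
have C : Ck_on k U (fun y : E => y 0 j - a 0 j).
  by apply: Ck_add => //; [exact: Ck_coord|exact: (@Ck_cst R n R)].
by apply: Ck_eq (Ck_mul oU C C) => // y _; rewrite expr2.
Qed.

Lemma sqdist_ge a y : `|y - a| ^+ 2 <= sqdist a y.
Proof.
have s0 : 0 <= sqdist a y by apply: sumr_ge0 => k _; rewrite sqr_ge0.
rewrite -(sqr_sqrtr s0) ler_pXn2r ?nnegrE ?sqrtr_ge0//.
apply: rV_norm_le => [|k]; first exact: sqrtr_ge0.
rewrite -sqrtr_sqr ler_wsqrtr// !mxE /sqdist (bigD1 k)//= lerDl.
by apply: sumr_ge0 => j _; rewrite sqr_ge0.
Qed.

(** The quotient [flat u / (flat u + flat (1 - u))] is 1 where u >= 1 and 0 where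
    u <= 0; the function u is affine in the squared Euclidean distance to a, with
    constants such that the support lies in the given neighbourhood. *)
Lemma bump_exists (a : E) (U : set E) : open U -> U a ->
  exists (b : E -> R) (K : set E), [/\ compact K, K `<=` U,
    (forall y, ~ K y -> b y = 0), (forall k, Ck_on k setT b) &
    \forall y \near a, b y = 1].
Proof.
move=> oU Ua; have /nbhs_ballP[r/= r0 Hr] := open_nbhs_nbhs (conj oU Ua).
pose c := 4 / r ^+ 2; have c0 : 0 < c by rewrite divr_gt0// exprn_gt0.
pose u y := 2 - c * sqdist a y.
pose den y := flat 0 (u y) + flat 0 (1 - u y).
have den0 y : den y != 0.
  rewrite gt_eqF// /den; have [u0|u0] := ltP 0 (u y).
    by rewrite ltr_pwDl ?flat0_gt0 ?flat_ge0.
  by rewrite ltr_wpDl ?flat0_gt0 ?flat_ge0// subr_gt0 (le_lt_trans u0).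
have Cs k : Ck_on k setT (sqdist a) by exact/Ck_sqdist/openT.
have Cc (d : R) k : @Ck_on R n k R setT (fun=> d) by exact: (@Ck_cst R n R).
have Cu k : Ck_on k setT u.
  by apply: Ck_add openT (Cc _ _) _; apply: Ck_opp openT _; exact: Ck_mul openT (Cc _ _) (Cs _).
have Cf k (v : E -> R) : Ck_on k setT v -> Ck_on k setT (flat 0 \o v).
  move=> Cv; exact: (@Ck_family R n k setT v flat (fun m => - m%:R) (fun=> 1) 0 openT (@is_derive_flat R) Cv).
exists (fun y => flat 0 (u y) / den y), [set y | sqdist a y <= r ^+ 2 / 2]; split.
- apply: bounded_closed_compact.
    exists (`|a| + r); split; first exact: num_real.
    move=> M MM y /= yK; apply: le_trans (ltW MM).
    rewrite -[y](subrK a) addrC; apply: (le_trans (ler_normD _ _)); rewrite lerD2l.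
    rewrite -(@ler_pXn2r _ 2) ?nnegrE ?(ltW r0)//.
    apply: (le_trans (sqdist_ge _ _)); apply: (le_trans yK).
    by rewrite ler_pdivrMr// ler_peMr ?exprn_ge0 ?(ltW r0)// ler1n.
  apply: (@closed_comp _ _ (sqdist a) [set t | t <= r ^+ 2 / 2]); last exact: closed_le.
  by move=> y _; exact: Ck_continuous (Cs 0) I.
- move=> y /= yK; apply: Hr; rewrite -ball_normE/= distrC.
  rewrite -(@ltr_pXn2r _ 2) ?nnegrE ?(ltW r0)//.
  apply: (le_lt_trans (sqdist_ge _ _)); apply: (le_lt_trans yK).
  by rewrite ltr_pdivrMr// ltr_pMr ?exprn_gt0// ltr1n.
- move=> y /= /negP; rewrite -ltNge => yK; rewrite [flat 0 _]/flat ifF ?mul0r//.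
  apply/negbTE; rewrite -leNgt /u subr_le0 /c.
  have -> : 2 = 4 / r ^+ 2 * (r ^+ 2 / 2) :> R by field; rewrite gt_eqF.
  by rewrite ler_wpM2l ?ltW.
- move=> k; apply: Ck_mul openT _ _; first exact: Cf.
  apply: Ck_inv openT (fun y _ => den0 y) _.
  apply: Ck_add openT _ _; apply: Cf => //.
  by apply: Ck_add openT (Cc _ _) _; exact: Ck_opp openT _.
- have s0 : sqdist a a = 0.
    by rewrite /sqdist big1// => k _; rewrite subrr expr0n/=.
  have r4 : 0 < r ^+ 2 / 4 by rewrite divr_gt0// exprn_gt0.
  have Ca : {for a, continuous (sqdist a)} by exact: Ck_continuous (Cs 0) I.
  have := @near_dist_le R E R _ _ _ Ca r4; apply: filterS => y; rewrite s0.
  rewrite sub0r normrN => /(le_trans (ler_norm _)) yK.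
  have u1 : 1 <= u y.
    rewrite /u lerBrDl -lerBrDr /c; apply: (le_trans (ler_wpM2l (ltW c0) yK)).
    have -> : 4 / r ^+ 2 * (r ^+ 2 / 4) = 1 by field; rewrite gt_eqF.
    by lra.
  have f0 : flat 0 (1 - u y) = 0 by rewrite /flat ifF// ltNge subr_le0 u1.
  by have := den0 y; rewrite /den f0 addr0 => ?; rewrite divff.
Qed.

End Bump.

(** * Charts, and extension of a tangent vector to a vector field *)

Section Manifolds.
Context {R : realType} {n : nat} {M : ptopologicalType} (A : manifold R n M).
Local Notation E := 'rV[R]_n.
Implicit Types (i j k : chart A) (p : M) (x y u : E).

Lemma chart_img_coord i p : chart_dom i p -> chart_img i (coord i p).
Proof. by exists p. Qed.

Lemma param_dom i x : chart_img i x -> chart_dom i (param i x).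
Proof. by case=> p ip <-; rewrite coordK. Qed.

Lemma paramK i x : chart_img i x -> coord i (param i x) = x.
Proof. by case=> p ip <-; rewrite coordK. Qed.

Lemma open_chart_img i : open (chart_img i).
Proof. exact: chart_img_open. Qed.

Lemma open_chart_preimage i (B : set M) : open B ->
  open (chart_img i `&` param i @^-1` B).
Proof.
move=> oB; rewrite openE => x [ix Bx]; apply: filterI.
  by apply: open_near ix; exact: open_chart_img.
have xE : x = coord i (param i x) by rewrite paramK.
have := @param_continuous _ _ _ A i (param i x) (param_dom ix).
rewrite -xE => c; apply: c; exact: open_nbhs_nbhs.
Qed.

Definition overlap i j : set E := chart_img i `&` param i @^-1` chart_dom j.

Lemma overlapE i j : coord i @` (chart_dom i `&` chart_dom j) = overlap i j.
Proof.
apply/seteqP; split => [_ [p [ip jp] <-]|x [ix jx]].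
  by split; [exact: chart_img_coord|rewrite /= coordK].
by exists (param i x); [split=> //; exact: param_dom|rewrite paramK].
Qed.

Lemma open_overlap i j : open (overlap i j).
Proof. exact/open_chart_preimage/chart_dom_open. Qed.

Definition transition i j : E -> E := coord j \o param i.

Lemma overlap_coord i j p : chart_dom i p -> chart_dom j p -> overlap i j (coord i p).
Proof. by move=> ip jp; rewrite -overlapE; exists p. Qed.

Lemma transition_coord i j p : chart_dom i p -> transition i j (coord i p) = coord j p.
Proof. by move=> ip; rewrite /transition/= coordK. Qed.

Lemma transition_overlap i j x : overlap i j x -> overlap j i (transition i j x).
Proof.
by rewrite -overlapE => -[p [ip jp] <-]; rewrite transition_coord//; exact: overlap_coord.
Qed.

Lemma smooth_transition i j : smooth_on (overlap i j) (transition i j).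
Proof. by rewrite -overlapE; exact: transition_smooth. Qed.

Lemma transition_differentiable i j x : overlap i j x -> differentiable (transition i j) x.
Proof. exact: Ck_mx_differentiable (@open_overlap i j) (@smooth_transition i j 1). Qed.

Lemma transition_diff_comp i j k p u :
  chart_dom i p -> chart_dom j p -> chart_dom k p ->
  transition_diff i k p u = transition_diff j k p (transition_diff i j p u).
Proof.
move=> ip jp kp; rewrite /transition_diff -/(transition i k) -/(transition j k) -/(transition i j).
rewrite -(transition_coord j ip) -derive_comp; last 2 first.
- by apply: transition_differentiable; exact: overlap_coord.
- by rewrite transition_coord//; apply: transition_differentiable; exact: overlap_coord.
apply: near_eq_derive; near=> x.
have [ix jx] : overlap i j x.
  by near: x; apply: open_near; [exact: open_overlap|exact: overlap_coord].
by rewrite /transition/= coordK.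
Unshelve. all: by end_near. Qed.

Lemma transition_diff_id i p u : chart_dom i p -> transition_diff i i p u = u.
Proof.
move=> ip; rewrite /transition_diff -[RHS](@derive_id R E (coord i p) u).
apply: near_eq_derive; near=> x.
rewrite /= paramK//; near: x.
by apply: open_near; [exact: open_chart_img|exact: chart_img_coord].
Unshelve. all: by end_near. Qed.

Lemma transition_diffZ i j p u (a : R) : chart_dom i p -> chart_dom j p ->
  transition_diff i j p (a *: u) = a *: transition_diff i j p u.
Proof.
move=> ip jp; have d := transition_differentiable (overlap_coord ip jp).
by rewrite /transition_diff !(deriveE _ d) linearZ.
Qed.

Section Extension.
Variables (i : chart A) (u : E) (b : E -> R) (K : set E).
Hypothesis cK : compact K.
Hypothesis Ki : K `<=` chart_img i.
Hypothesis b0 : forall y, ~ K y -> b y = 0.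
Hypothesis Cb : forall m, Ck_on m setT b.

(** The vector u, constant in the chart i, cut off by b and read in the chart j. *)
Definition ext_comp j (y : E) : E :=
  if `[< chart_dom i (param j y) >] then
    b (coord i (param j y)) *: transition_diff i j (param j y) u
  else 0.

Lemma compact_param_support : compact (param i @` K).
Proof.
apply: continuous_compact => //.
apply: continuous_in_subspaceT => y; rewrite inE => /Ki iy.
by have := @param_continuous _ _ _ A i (param i y) (param_dom iy); rewrite paramK.
Qed.

(** Near a point of the domain of the chart i this is a composition of smooth
    functions. A point outside that domain is outside the support, which is compact
    and therefore closed in M, so the components vanish nearby. *)
Lemma ext_comp_smooth j : smooth_on (chart_img j) (ext_comp j).
Proof.
move=> m; apply: Ck_local => y jy.
have [iy|iy] := pselect (chart_dom i (param j y)).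
  exists (overlap j i) => //.
  have oji := @open_overlap j i; have oij := @open_overlap i j.
  have C1 : Ck_on m (overlap j i) (b \o transition j i).
    by apply: (Ck_comp oji openT) => //; exact: smooth_transition.
  have C2 l : Ck_on m (overlap j i) ((fun z => 'D_u (transition i j) z 0 l) \o transition j i).
    apply: (Ck_comp oji oij) => //; first exact: transition_overlap.
      exact: smooth_transition.
    by have /(Ck_mxP _ _ oij) := Ck_derive u (@smooth_transition i j m.+1); apply.
  apply/Ck_mxP => // r l; rewrite (ord1 r).
  apply: Ck_eq (Ck_mul oji C1 (C2 l)) => // z [_ iz].
  by rewrite /ext_comp asboolT//= mxE.
exists (chart_img j `&` param j @^-1` (~` (param i @` K))).
  split=> // -[z Kz zy]; apply: iy; rewrite -zy; apply: param_dom; exact: Ki.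
have oV : open (chart_img j `&` param j @^-1` (~` (param i @` K))).
  apply: open_chart_preimage; apply: closed_openC; apply: compact_closed.
    exact: manifold_hausdorff A.
  exact: compact_param_support.
apply: Ck_eq (Ck_cst m _ 0) => // z [jz Kz]; rewrite /ext_comp.
case: asboolP => // iz; rewrite b0 ?scale0r// => Kc; apply: Kz.
by exists (coord i (param j z)) => //; rewrite coordK.
Qed.

Lemma ext_comp_change j k p : chart_dom j p -> chart_dom k p ->
  ext_comp k (coord k p) = transition_diff j k p (ext_comp j (coord j p)).
Proof.
move=> jp kp; rewrite /ext_comp !coordK//; case: asboolP => ip.
  by rewrite transition_diffZ// -transition_diff_comp.
by rewrite /transition_diff derive0.
Qed.

Definition ext_field : vector_field A :=
  @VectorField R n M A ext_comp ext_comp_smooth ext_comp_change.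

End Extension.

Lemma vector_field_extension i x u : chart_img i x ->
  exists X : vector_field A, \forall y \near x, X i y = u.
Proof.
move=> ix; have [b [K [cK Ki b0 Cb b1]]] := bump_exists (@open_chart_img i) ix.
exists (ext_field u cK Ki b0 Cb).
have ix' : \forall y \near x, chart_img i y by apply: open_near ix; exact: open_chart_img.
apply: filterS2 b1 ix' => y b1 iy.
rewrite /= /ext_comp asboolT; last exact: param_dom.
by rewrite transition_diff_id ?paramK ?b1 ?scale1r//; exact: param_dom.
Qed.

End Manifolds.

(** * Smooth matrix-valued functions, and maxima *)

Lemma opposite_signs_absurd {R : realFieldType} (d e1 e2 : R) : 0 < `|d| ->
  `|d - e1| <= `|d| / 2 -> e1 <= 0 -> `|d - e2| <= `|d| / 2 -> 0 <= e2 -> False.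
Proof.
move=> d0; rewrite !ler_norml => /andP[a1 a2] e10 /andP[b1 b2] e20.
by case: (ltrgt0P d) d0 a1 a2 b1 b2; lra.
Qed.

Lemma gt0_of_close {R : realFieldType} (a b : R) : 0 < a -> `|a - b| <= a / 2 -> 0 < b.
Proof. by move=> a0; rewrite ler_norml => /andP[_]; lra. Qed.

Section MatrixCalculus.
Context {R : realType} {n : nat}.
Local Notation E := 'rV[R]_n.
Variables (U : set E).
Hypothesis oU : open U.

Lemma smooth_derivable (F : normedModType R) (f : E -> F) x v :
  smooth_on U f -> U x -> derivable f x v.
Proof. by move=> Sf Ux; exact: (Ck_derivable (Sf 1)). Qed.

Lemma smooth_derive (F : normedModType R) (f : E -> F) v :
  smooth_on U f -> smooth_on U ('D_v f).
Proof. by move=> Sf k; exact: (Ck_derive v (Sf k.+1)). Qed.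

Lemma smooth_mxP p q (f : E -> 'M[R]_(p, q)) :
  smooth_on U f <-> forall i j, smooth_on U (fun x => f x i j).
Proof.
split=> [Sf i j k|Sf k]; first by have /(Ck_mxP _ _ oU) := Sf k; apply.
by apply/(Ck_mxP _ _ oU) => i j; exact: Sf.
Qed.

Lemma smooth_mulmx p q r (f : E -> 'M[R]_(p, q)) (g : E -> 'M[R]_(q, r)) :
  smooth_on U f -> smooth_on U g -> smooth_on U (fun x => f x *m g x).
Proof.
move=> /smooth_mxP Sf /smooth_mxP Sg; apply/smooth_mxP => i j k.
have C : Ck_on k U (fun x => \sum_l f x i l * g x l j).
  by apply: Ck_sum => // l _; apply: Ck_mul; [|exact: Sf|exact: Sg].
by apply: Ck_eq C => // x _; rewrite mxE.
Qed.

Lemma smooth_add (F : normedModType R) (f g : E -> F) :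
  smooth_on U f -> smooth_on U g -> smooth_on U (fun x => f x + g x).
Proof. by move=> Sf Sg k; apply: Ck_add. Qed.

Lemma smooth_opp (F : normedModType R) (f : E -> F) :
  smooth_on U f -> smooth_on U (fun x => - f x).
Proof. by move=> Sf k; apply: Ck_opp. Qed.

Lemma smooth_cst (F : normedModType R) (c : F) : smooth_on U (fun=> c).
Proof. by move=> k; exact: Ck_cst. Qed.

Lemma smooth_trmx p q (f : E -> 'M[R]_(p, q)) :
  smooth_on U f -> smooth_on U (fun x => (f x)^T).
Proof.
move=> /smooth_mxP Sf; apply/smooth_mxP => i j k.
by apply: Ck_eq (Sf j i k) => // x _; rewrite mxE.
Qed.

Lemma smooth_mxtrace (f : E -> 'M[R]_n) :
  smooth_on U f -> smooth_on U (fun x => \tr (f x)).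
Proof. by move=> /smooth_mxP Sf k; apply: Ck_sum => // i _; exact: Sf. Qed.

Lemma smooth_scalar_mx (f : E -> R) :
  smooth_on U f -> smooth_on U (fun x => (f x)%:M : 'M[R]_n).
Proof.
move=> Sf; apply/smooth_mxP => i j k.
have C : Ck_on k U (fun x => f x * (i == j)%:R).
  by apply: (Ck_mul oU); [exact: Sf|exact: (@Ck_cst R n R)].
by apply: Ck_eq C => // x _; rewrite mxE mulr_natr.
Qed.

Lemma smooth_det m (f : E -> 'M[R]_m) : smooth_on U f -> smooth_on U (fun x => \det (f x)).
Proof.
move=> /smooth_mxP Sf k; apply: Ck_sum => // s _; apply: Ck_mul => //.
  exact: (@Ck_cst R n R).
by apply: Ck_prod => // i _; exact: Sf.
Qed.

Lemma smooth_invmx m (f : E -> 'M[R]_m) : (forall x, U x -> f x \in unitmx) ->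
  smooth_on U f -> smooth_on U (fun x => invmx (f x)).
Proof.
move=> fu Sf; apply/smooth_mxP => i j k.
have C : Ck_on k U (fun x => (\det (f x))^-1 *
    ((-1) ^+ (j + i) * \det (row' j (col' i (f x))))).
  apply: Ck_mul => //.
    apply: (Ck_inv oU); first by move=> x /fu; rewrite unitmxE unitfE.
    exact: smooth_det.
  apply: Ck_mul => //; first exact: (@Ck_cst R n R).
  apply: smooth_det; apply/smooth_mxP => a b l.
  have /smooth_mxP S := Sf.
  by apply: Ck_eq (S (lift j a) (lift i b) l) => // x _; rewrite !mxE.
by apply: Ck_eq C => // x Ux; rewrite /invmx fu// !mxE.
Qed.

Section Rules.
Variables (x : E) (v : E).
Hypothesis Ux : U x.

Lemma derive_entry p q (f : E -> 'M[R]_(p, q)) i j : smooth_on U f ->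
  'D_v (fun y => f y i j) x = 'D_v f x i j.
Proof. by move=> Sf; rewrite derive_mx ?mxE//; exact: smooth_derivable. Qed.

Lemma smooth_entry p q (f : E -> 'M[R]_(p, q)) i j : smooth_on U f ->
  smooth_on U (fun y => f y i j).
Proof. by move=> /smooth_mxP; apply. Qed.

Lemma derive_mulmx p q r (f : E -> 'M[R]_(p, q)) (g : E -> 'M[R]_(q, r)) :
  smooth_on U f -> smooth_on U g ->
  'D_v (fun y => f y *m g y) x = 'D_v f x *m g x + f x *m 'D_v g x.
Proof.
move=> Sf Sg; apply/matrixP => i j.
rewrite -(derive_entry _ _ (smooth_mulmx Sf Sg)) !mxE -big_split/=.
have -> : (fun y => (f y *m g y) i j) =
    \sum_l (fun y => f y i l * g y l j).
  by apply/funext => y; rewrite mxE fct_sumE.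
have d1 l : derivable (fun y => f y i l) x v.
  by apply: smooth_derivable => //; exact: smooth_entry.
have d2 l : derivable (fun y => g y l j) x v.
  by apply: smooth_derivable => //; exact: smooth_entry.
rewrite derive_sum => [|l]; last by apply: derivableM.
apply: eq_bigr => l _; rewrite deriveM// !derive_entry//.
by rewrite addrC; congr (_ + _); rewrite /GRing.scale/= mulrC.
Qed.

Lemma derive_add (F : normedModType R) (f g : E -> F) : smooth_on U f -> smooth_on U g ->
  'D_v (fun y => f y + g y) x = 'D_v f x + 'D_v g x.
Proof. by move=> Sf Sg; rewrite [LHS]deriveD//; exact: smooth_derivable. Qed.

Lemma derive_opp (F : normedModType R) (f : E -> F) : smooth_on U f ->
  'D_v (fun y => - f y) x = - 'D_v f x.
Proof. by move=> Sf; rewrite [LHS]deriveN//; exact: smooth_derivable. Qed.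

Lemma derive_mulr (f g : E -> R) : smooth_on U f -> smooth_on U g ->
  'D_v (fun y => f y * g y) x = 'D_v f x * g x + f x * 'D_v g x.
Proof.
move=> Sf Sg; rewrite [LHS]deriveM; [|exact: smooth_derivable..].
by rewrite addrC; congr (_ + _); rewrite /GRing.scale/= mulrC.
Qed.

Lemma derive_trmx p q (f : E -> 'M[R]_(p, q)) : smooth_on U f ->
  'D_v (fun y => (f y)^T) x = ('D_v f x)^T.
Proof.
move=> Sf; apply/matrixP => i j.
rewrite -(derive_entry _ _ (smooth_trmx Sf)) mxE -derive_entry//.
by congr ('D_v _ x); apply/funext => y; rewrite mxE.
Qed.

Lemma derive_mxtrace (f : E -> 'M[R]_n) : smooth_on U f ->
  'D_v (fun y => \tr (f y)) x = \tr ('D_v f x).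
Proof.
move=> Sf; have -> : (fun y => \tr (f y)) = \sum_i (fun y => f y i i).
  by apply/funext => y; rewrite fct_sumE.
rewrite derive_sum => [|i]; last by apply: smooth_derivable => //; exact: smooth_entry.
by apply: eq_bigr => i _; exact: derive_entry.
Qed.

Lemma derive_scalar_mx (f : E -> R) : smooth_on U f ->
  'D_v (fun y => (f y)%:M : 'M[R]_n) x = ('D_v f x)%:M.
Proof.
move=> Sf; apply/matrixP => i j.
rewrite -(derive_entry _ _ (smooth_scalar_mx Sf)) mxE.
have -> : (fun y => (f y)%:M i j) = (fun y => f y * (i == j)%:R).
  by apply/funext => y; rewrite mxE mulr_natr.
by rewrite (derive_mulr Sf (smooth_cst _)) derive_cst mulr0 addr0 mulr_natr.
Qed.

Lemma derive_eq_on (F : normedModType R) (f g : E -> F) : (forall y, U y -> f y = g y) ->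
  'D_v f x = 'D_v g x.
Proof.
move=> fg; apply: near_eq_derive; near=> y; apply: fg.
by near: y; exact: open_near.
Unshelve. all: by end_near. Qed.

Lemma derive_lin_mx p q (f : E -> 'M[R]_(p, q)) : smooth_on U f ->
  'D_v f x = \sum_c v 0 c *: 'D_(basis c) f x.
Proof.
move=> Sf; apply/matrixP => i j; rewrite -(derive_entry _ _ Sf) derive_lin.
  by rewrite summxE; apply: eq_bigr => c _; rewrite mxE derive_mx ?mxE//; exact: smooth_derivable.
exact: (Ck_differentiable oU (smooth_entry i j Sf 1)).
Qed.

End Rules.

Lemma Schwarz_mx p q (f : E -> 'M[R]_(p, q)) x v w : U x -> smooth_on U f ->
  'D_w ('D_v f) x = 'D_v ('D_w f) x.
Proof.
move=> Ux Sf; apply/matrixP => i j.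
have Svf := smooth_derive v Sf; have Swf := smooth_derive w Sf.
have H z y : U y -> 'D_z f y i j = 'D_z (fun y => f y i j) y.
  by move=> Uy; rewrite derive_entry.
have e1 := etrans (esym (derive_entry w Ux i j Svf)) (derive_eq_on w Ux (H v)).
have e2 := etrans (esym (derive_entry v Ux i j Swf)) (derive_eq_on v Ux (H w)).
apply: (etrans e1); apply: (etrans _ (esym e2)).
exact: (Schwarz w v oU Ux (smooth_entry i j Sf 2)).
Qed.

Lemma locally_constant (f : E -> R) x : U x -> smooth_on U f ->
  (forall y a, U y -> 'D_(basis a) f y = 0) -> \forall y \near x, f y = f x.
Proof.
move=> Ux Sf D0.
have /nbhs_ballP[r/= r0 Hr] := open_nbhs_nbhs (conj oU Ux).
apply/nbhs_ballP; exists r => // y; rewrite -ball_normE/= distrC => yr.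
have B t : `|t| <= 1 -> U (x + t *: (y - x)).
  move=> t1; apply: Hr; rewrite -ball_normE/= opprD addrA subrr sub0r normrN normrZ.
  by apply: le_lt_trans yr; rewrite ler_piMl.
have [t|c c1] := @MVT_line R _ f x (y - x) 1.
  by rewrite normr1 => /B Ut; exact: smooth_derivable.
rewrite scale1r mul1r [x + _]addrC subrK => /eqP.
rewrite derive_lin; last first.
  by apply: (Ck_differentiable oU (Sf 1)); apply: B; rewrite -(normr1 R).
rewrite big1 => [|k _]; last by rewrite D0 ?mulr0//; apply: B; rewrite -(normr1 R).
by rewrite subr_eq0 => /eqP.
Qed.

(** If the second derivative along v were positive, f would increase along the
    line through x directed by v. *)
Lemma local_max_derive (f : E -> R) x v : U x -> smooth_on U f ->
  (forall y, U y -> f y <= f x) -> 'D_v f x = 0 /\ 'D_v ('D_v f) x <= 0.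
Proof.
move=> Ux Sf fmax.
have near_line (P : set E) : (\forall y \near x, P y) ->
    exists2 h : R, 0 < h & forall t, `|t| <= h -> P (x + t *: v).
  move=> /nbhs_ballP[r/= r0 Hr]; pose K := `|v| + 1.
  have K0 : 0 < K by rewrite ltr_pwDr.
  exists (r / 2 / K) => [|t tr]; first by rewrite !divr_gt0.
  apply: Hr; rewrite -ball_normE/= opprD addrA subrr sub0r normrN normrZ.
  apply: (@le_lt_trans _ _ (r / 2 / K * K)); last first.
    by rewrite divfK ?gt_eqF// ltr_pdivrMr// mulr_natr mulr2n ltrDl.
  by apply: ler_pM => //; rewrite lerDl.
have Sv := smooth_derive v Sf; have Svv := smooth_derive v Sv.
have cv := @near_dist_le R E R _ x _ (Ck_continuous (Sv 0) Ux).
have cvv := @near_dist_le R E R _ x _ (Ck_continuous (Svv 0) Ux).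
have oUx := open_near oU Ux.
have D0 : 'D_v f x = 0.
  apply/eqP; rewrite -normr_le0 leNgt; apply/negP => d0.
  have d20 : 0 < `|'D_v f x| / 2 by rewrite divr_gt0.
  have [h1 h10 H1] := near_line _ (cv _ d20).
  have [h2 h20 H2] := near_line _ oUx.
  pose h := Num.min h1 h2; have h0 : 0 < h by rewrite lt_min h10.
  have Uh t : `|t| <= h -> U (x + t *: v) by rewrite le_min => /andP[_]; exact: H2.
  have Dh t : `|t| <= h -> `|'D_v f x - 'D_v f (x + t *: v)| <= `|'D_v f x| / 2.
    by rewrite le_min => /andP[/H1].
  have key s : `|s| = h -> exists2 e, `|'D_v f x - e| <= `|'D_v f x| / 2 & s * e <= 0.
    move=> sh; have [t|c] := @MVT_line R _ f x v s.
      by rewrite sh => /Uh Ut; exact: smooth_derivable.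
    rewrite sh => ch E; exists ('D_v f (x + c *: v)); first exact: Dh.
    by rewrite -E subr_le0; apply: fmax; apply: Uh; rewrite sh.
  have [e1] := key _ (gtr0_norm h0).
  have [e2] : exists2 e, `|'D_v f x - e| <= `|'D_v f x| / 2 & - h * e <= 0.
    by apply: key; rewrite normrN gtr0_norm.
  rewrite mulNr oppr_le0 !pmulr_rge0 ?pmulr_rle0// => e2d e20 e1d e10.
  exact: opposite_signs_absurd d0 e1d e10 e2d e20.
split=> //; rewrite leNgt; apply/negP => s0.
have s20 : 0 < 'D_v ('D_v f) x / 2 by rewrite divr_gt0.
have [h1 h10 H1] := near_line _ (cvv _ s20).
have [h2 h20 H2] := near_line _ oUx.
pose h := Num.min h1 h2; have h0 : 0 < h by rewrite lt_min h10.
have Uh t : `|t| <= h -> U (x + t *: v) by rewrite le_min => /andP[_]; exact: H2.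
have pos t : `|t| <= h -> 0 < 'D_v ('D_v f) (x + t *: v).
  by rewrite le_min => /andP[/H1 /(gt0_of_close s0)].
have [t /andP[t0 th]|c /andP[c0 ch] E] := @MVT_line_gt0 R _ f x v h h0.
  by apply: smooth_derivable => //; apply: Uh; rewrite ger0_norm.
have [t /andP[t0 tc]|c' /andP[c'0 c'c]] := @MVT_line_gt0 R _ ('D_v f) x v c c0.
  by apply: smooth_derivable => //; apply: Uh; rewrite ger0_norm// (le_trans tc)// ltW.
rewrite D0 subr0 => E'.
have c'h : `|c'| <= h by rewrite ger0_norm ltW// (lt_trans c'c).
have inc : 0 < f (x + h *: v) - f x.
  by rewrite E E'; exact: mulr_gt0 h0 (mulr_gt0 c0 (pos _ c'h)).
move: inc; apply/negP; rewrite subr_gt0 -leNgt; apply: fmax; apply: Uh.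
by rewrite gtr0_norm.
Qed.

End MatrixCalculus.

(** * Linear algebra of inner products *)

Section MatrixIdentities.
Context {R : realType} {n : nat}.
Implicit Types (u : 'rV[R]_n).

Lemma eq_mx_basis p (A B : 'M[R]_(n, p)) :
  (forall b, basis b *m A = basis b *m B) -> A = B.
Proof. by move=> AB; apply/row_matrixP => b; rewrite !rowE; exact: AB. Qed.

Lemma form_basis (A : 'M[R]_n) u b : form A u (basis b) = (u *m A) 0 b.
Proof.
rewrite /form mxE (bigD1 b)//= big1 ?addr0 => [|c cb]; first by rewrite !mxE !eqxx mulr1.
by rewrite !mxE (negbTE cb) mulr0.
Qed.

Lemma mxtrace_commutator (A B : 'M[R]_n) : \tr (A *m B - B *m A) = 0.
Proof. by rewrite linearB/= mxtrace_mulC subrr. Qed.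

Lemma scalar_mx0 : (0 : R)%:M = 0 :> 'M[R]_n.
Proof. by apply/matrixP => a b; rewrite !mxE mul0rn. Qed.

Lemma sub_scalar_mxA (B : 'M[R]_n) (a c : R) : B - a%:M - c%:M = B - (a + c)%:M.
Proof. by apply/matrixP => k l; rewrite !mxE mulrnDl opprD addrA. Qed.

Lemma commutator_shift (A H : 'M[R]_n) (c : R) :
  A *m H - H *m A = A *m (H - c%:M) - (H - c%:M) *m A.
Proof.
rewrite mulmxBr mulmxBl scalar_mxC.
by move: (A *m H) (H *m A) (A *m c%:M) => *; apply/matrixP => i j; rewrite !mxE; ring.
Qed.

Lemma trmx_add p q (A B : 'M[R]_(p, q)) : (A + B)^T = A^T + B^T.
Proof. by apply/matrixP => i j; rewrite !mxE. Qed.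

Lemma trmx_sub p q (A B : 'M[R]_(p, q)) : (A - B)^T = A^T - B^T.
Proof. by apply/matrixP => i j; rewrite !mxE. Qed.

(** This lemma and the next five only rearrange sums; the opaque matrices stand for
    products and derivatives of components. *)
Lemma trmx_alternating p q (m1 m2 m3 m4 : 'M[R]_(p, q)) :
  (m1 - m2 + m3 - m4)^T = m1^T - m2^T + m3^T - m4^T.
Proof. by apply/matrixP => i j; rewrite !mxE. Qed.

Lemma antisym_cancel p q (m1 m2 m3 m4 : 'M[R]_(p, q)) :
  m1 - m2 + m3 - m4 + (m2 - m1 + m4 - m3) = 0.
Proof. by apply/matrixP => i j; rewrite !mxE; ring. Qed.

Lemma nabla_cancel p q (m1 m2 m3 m4 : 'M[R]_(p, q)) :
  m1 + m2 - m4 = m1 + (m2 + m3) - (m3 + m4).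
Proof. by apply/matrixP => i j; rewrite !mxE; ring. Qed.

Lemma scalar_cancel p q (m1 m2 m3 m4 : 'M[R]_(p, q)) :
  m1 + m2 - m3 - m1 = m2 - m4 - (m3 - m4).
Proof. by apply/matrixP => i j; rewrite !mxE; ring. Qed.

Lemma curvature_opp (d1 d2 n1 n2 A C : 'M[R]_n) : n1 = - d1 -> n2 = - d2 ->
  n1 - n2 + - A *m - C - - C *m - A = d2 - d1 + A *m C - C *m A.
Proof. by move=> -> ->; rewrite !mulNmx !mulmxN !opprK [- d1 + _]addrC. Qed.

Lemma lie_cancel p q (m1 m2 m3 m4 m5 m6 m7 m8 g1 g2 g3 g4 g5 : 'M[R]_(p, q)) :
  g1 = m3 -> g2 = m7 -> g3 = m2 + m8 -> g4 = m6 -> g5 = m1 - m6 + m8 - m7 ->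
  m1 - m2 - - m3 - (- m4 - m5) = m4 + (g1 + g4) + (m5 + g2) - g3 + g5.
Proof. by move=> -> -> -> -> ->; apply/matrixP => i j; rewrite !mxE; ring. Qed.

(** A self-adjoint endomorphism that is also skew vanishes: this is what splits
    the affine conformal equation into its two halves. *)
Lemma sym_skew_split (g N S T : 'M[R]_n) (d : R) : g^T = g -> g \in unitmx ->
  (N *m g)^T = N *m g -> (S *m g)^T = - (S *m g) -> (T *m g)^T = - (T *m g) ->
  N + S = d%:M + T -> N = d%:M /\ S = T.
Proof.
move=> sg ug sN sS sT NS.
have W : N - d%:M = T - S.
  by apply/matrixP => i j; move/matrixP/(_ i j): NS; rewrite !mxE; lra.
have symW : ((N - d%:M) *m g)^T = (N - d%:M) *m g.
  by rewrite mulmxBl linearB/= sN mul_scalar_mx linearZ/= sg.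
have skewW : ((N - d%:M) *m g)^T = - ((N - d%:M) *m g).
  by rewrite W mulmxBl linearB/= sT sS; apply/matrixP => i j; rewrite !mxE; ring.
have W0 : (N - d%:M) *m g = 0.
  move: symW skewW; move: (_ *m g) => Z -> /matrixP ZE.
  by apply/matrixP => i j; move: (ZE i j); rewrite !mxE; lra.
have Nd : N - d%:M = 0 by rewrite -(mulmxK ug (N - _)) W0 mul0mx.
split; first by apply/eqP; rewrite -subr_eq0 Nd.
by apply/eqP; rewrite eq_sym -subr_eq0 -W Nd.
Qed.

End MatrixIdentities.

Section InnerProducts.
Context {R : realType} {n : nat}.
Implicit Types (G H N : 'M[R]_n) (u v : 'rV[R]_n).

Definition posdef G := G^T = G /\ forall u, u != 0 -> 0 < form G u u.

Lemma posdef_eq0 G u : posdef G -> u *m G *m u^T = 0 -> u = 0.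
Proof.
move=> [_ pG] uGu; apply/eqP/negP => /negP /pG.
by rewrite /form uGu mxE ltxx.
Qed.

Lemma posdef_unit G : posdef G -> G \in unitmx.
Proof.
move=> pG; rewrite -row_free_unit -kermx_eq0; apply/eqP/row_matrixP => i.
rewrite row0; apply: (posdef_eq0 pG).
by rewrite -row_mul mulmx_ker row0 mul0mx.
Qed.

(** A g-orthonormal family with fewer than n members is extended by a unit vector
    orthogonal to it, which exists for reasons of dimension. *)
Lemma orthonormal_frame G : posdef G -> exists C : 'M[R]_n, C *m G *m C^T = 1%:M.
Proof.
move=> pG; have [symG posG] := pG.
suff: forall k, (k <= n)%N -> exists C : 'M[R]_(k, n), C *m G *m C^T = 1%:M by move=> /(_ n (leqnn n)).
elim=> [|k IH] kn; first by exists 0; apply/matrixP => -[].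
have [C CGC] := IH (ltnW kn).
have : kermx (G *m C^T) != 0.
  rewrite kermx_eq0 /row_free neq_ltn (leq_ltn_trans (rank_leq_col _))//.
move=> /rowV0Pn[u uker u0]; have uGC : u *m G *m C^T = 0.
  by move/sub_kermxP: uker; rewrite mulmxA.
pose s := form G u u; have s0 : 0 < s by exact: posG.
pose w := (Num.sqrt s)^-1 *: u.
have wGC : w *m G *m C^T = 0 by rewrite /w -!scalemxAl uGC scaler0.
have CGw : C *m G *m w^T = 0.
  by apply: trmx_inj; rewrite !trmx_mul trmxK symG trmx0 mulmxA.
have wGw : w *m G *m w^T = 1%:M.
  rewrite /w linearZ/= -!scalemxAl -scalemxAr scalerA -invfM -expr2 sqr_sqrtr ?(ltW s0)//.
  by rewrite [u *m G *m u^T]mx11_scalar -/(form G u u) -/s -mul_scalar_mx -scalar_mxM mulVf ?gt_eqF.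
change (exists C : 'M[R]_(1 + k, n), C *m G *m C^T = 1%:M); exists (col_mx w C).
rewrite mul_col_mx tr_col_mx mul_col_row wGw wGC CGw CGC.
by rewrite (scalar_mx_block 1%N k).
Qed.

Definition selfadjoint G N := (N *m G)^T = N *m G.

(** In an orthonormal frame N is a symmetric matrix, and the trace of its square
    is the sum of the squares of its entries. *)
Lemma selfadjoint_trace_sqr_eq0 G N : posdef G -> selfadjoint G N ->
  \tr (N *m N) = 0 -> N = 0.
Proof.
move=> pG sN trN; have [C CGC] := orthonormal_frame pG.
have [symG _] := pG.
have CC : G *m C^T *m C = 1%:M by apply: mulmx1C; rewrite mulmxA.
pose S := C *m N *m (G *m C^T).
have symS : S^T = S.
  rewrite /S mulmxA -(mulmxA C N G) trmx_mul trmxK trmx_mul sN.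
  by rewrite mulmxA.
have trS : \tr (S *m S^T) = 0.
  have -> : S *m S^T = C *m N *m (G *m C^T *m C) *m N *m (G *m C^T).
    by rewrite symS /S !mulmxA.
  by rewrite CC mulmx1 mxtrace_mulC !mulmxA CC mul1mx.
have S0 : S = 0.
  apply/matrixP => i j; rewrite [RHS]mxE.
  have : \sum_a \sum_b S a b ^+ 2 = 0.
    rewrite -[RHS]trS; apply: eq_bigr => a _; rewrite mxE.
    by apply: eq_bigr => b _; rewrite [S^T _ _]mxE expr2.
  move=> /eqP; rewrite psumr_eq0 => [|a _]; last by apply: sumr_ge0 => b _; rewrite sqr_ge0.
  move=> /allP/(_ i); rewrite mem_index_enum => /(_ isT)/=.
  rewrite psumr_eq0 => [|b _]; last by rewrite sqr_ge0.
  move=> /allP/(_ j); rewrite mem_index_enum => /(_ isT)/=.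
  by rewrite sqrf_eq0 => /eqP.
have : G *m C^T *m S *m C = 0 by rewrite S0 mulmx0 mul0mx.
have -> : G *m C^T *m S *m C = (G *m C^T *m C) *m N *m (G *m C^T *m C).
  by rewrite /S !mulmxA.
by rewrite CC mul1mx mulmx1.
Qed.

(** Let v be the gradient, with g-dual d. Contracting the commutation relations
    with any Y gives, as endomorphisms of X,
      g(Y, v) HX - g(X, Y) Hv = g(HY, v) X - g(X, HY) v.
    The trace over X yields H v = mu v with mu = tr H / n. The same relations hold
    for N = H - mu I, which kills v, so Y = v gives |v|^2 N = 0. *)
Lemma scalar_of_commute G H (d : 'rV[R]_n) : (0 < n)%N -> posdef G ->
  selfadjoint G H -> d != 0 ->
  (forall a, let T := d^T *m basis a - (basis a *m G)^T *m (d *m invmx G) in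
     T *m H = H *m T) ->
  H = (\tr H / n%:R)%:M.
Proof.
move=> n0 pG sH d0 comm; have [symG posG] := pG.
have Gu := posdef_unit pG.
have [v vE] : exists v, v = d *m invmx G by exists (d *m invmx G).
rewrite -vE in comm.
have vG : v *m G = d by rewrite vE mulmxKV.
have Gv : G *m v^T = d^T by rewrite -vG trmx_mul symG.
have HG : G *m H^T = H *m G by rewrite -[in RHS]sH trmx_mul symG.
have commXY N : (forall a, let T := d^T *m basis a - (basis a *m G)^T *m v in T *m N = N *m T) ->
    forall (Y : 'rV[R]_n), (Y *m d^T) 0 0 *: N - G *m Y^T *m (v *m N) =
      (Y *m N *m d^T) 0 0 *: 1%:M - G *m (Y *m N)^T *m v.
  move=> cN Y; apply/row_matrixP => a; rewrite !rowE -/(basis a).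
  have sw (Z : 'rV[R]_n) : Z *m G *m (basis a)^T = basis a *m G *m Z^T.
    have tr11 (S : 'M[R]_1) : S^T = S by apply/matrixP => i j; rewrite !ord1 mxE.
    by rewrite -[LHS]tr11 !trmx_mul trmxK symG mulmxA.
  have := congr1 (mulmx Y) (cN a); rewrite /= mulmxBl !mulmxBr.
  rewrite [(basis a *m G)^T]trmx_mul symG !mulmxA !sw => E.
  rewrite [Y *m d^T]mx11_scalar [Y *m N *m d^T]mx11_scalar !mul_scalar_mx -scalemxAl in E.
  rewrite -!scalemxAr mulmx1 ?mulmxA; exact: E.
have trE (Y w : 'rV[R]_n) : \tr (G *m Y^T *m w) = (w *m G *m Y^T) 0 0.
  by rewrite mxtrace_mulC mulmxA trace_mx11.
(* The trace over X; the last terms on both sides cancel as H is self-adjoint. *)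
have Hd : H *m d^T = (\tr H / n%:R) *: d^T.
  have nN0 : n%:R != 0 :> R by rewrite pnatr_eq0 -lt0n.
  suff E (Y : 'rV[R]_n) : Y *m (H *m d^T) = Y *m ((\tr H / n%:R) *: d^T).
    by apply/row_matrixP => i; rewrite !rowE.
  apply/matrixP => i j; rewrite !ord1 -scalemxAr mulmxA.
  have := congr1 mxtrace (commXY H comm Y).
  rewrite !linearB/= !linearZ/= mxtrace1 !trE trmx_mul !mulmxA.
  have -> : v *m H *m G *m Y^T = v *m G *m H^T *m Y^T.
    by rewrite -(mulmxA v H G) -HG !mulmxA.
  move/addIr => E; rewrite [RHS]mxE; apply: (mulIf nN0); rewrite -E.
  by rewrite [RHS]mulrAC divfK// mulrC.
pose mu := \tr H / n%:R.
have [N NE] : exists N, N = H - mu%:M by exists (H - mu%:M).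
have Nd : N *m d^T = 0 by rewrite NE mulmxBl Hd mul_scalar_mx subrr.
have sN : (N *m G)^T = N *m G.
  by rewrite NE mulmxBl linearB/= sH mul_scalar_mx linearZ/= symG.
have vN : v *m N = 0.
  have : v *m N *m G = 0.
    have NG : G *m N^T = N *m G by rewrite -[in RHS]sN trmx_mul symG.
    by rewrite -mulmxA -NG mulmxA vG; apply: trmx_inj; rewrite trmx_mul trmxK Nd trmx0.
  by move/(congr1 (mulmx^~ (invmx G))); rewrite mulmxK// mul0mx.
have commN : forall a, let T := d^T *m basis a - (basis a *m G)^T *m v in T *m N = N *m T.
  move=> a T; rewrite NE mulmxBr [RHS]mulmxBl; congr (_ - _); first exact: comm.
  by rewrite scalar_mxC.
have v0 : v != 0 by apply: contra_neq d0 => v0; rewrite -vG v0 mul0mx.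
have := commXY N commN v.
rewrite vN mulmx0 subr0 mul0mx trmx0 mulmx0 mul0mx subr0.
rewrite [(0 : 'M[R]_1) 0 0]mxE scale0r -Gv mulmxA -/(form G v v) => /eqP.
rewrite scaler_eq0 gt_eqF ?posG//= NE subr_eq0 => /eqP.
by [].
Qed.

End InnerProducts.

(** * The Levi-Civita connection and an affine conformal field in a chart *)

Section LocalGeometry.
Context {R : realType} {n : nat}.
Local Notation E := 'rV[R]_n.
Variables (U : set E) (G : E -> 'M[R]_n) (xi : E -> E) (r : E -> R).
Hypothesis oU : open U.
Hypothesis SG : smooth_on U G.
Hypothesis pG : forall x, U x -> posdef (G x).
Hypothesis Sxi : smooth_on U xi.
Hypothesis Sr : smooth_on U r.
Implicit Types (x y u v w : E) (a b c : 'I_n).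

Definition christoffel_mx a x : 'M[R]_n := \matrix_(b, c) christoffel G x a b c.
Definition connection_mx w x : 'M[R]_n := \sum_a w 0 a *: christoffel_mx a x.

Lemma connection_mx_basis a x : connection_mx (basis a) x = christoffel_mx a x.
Proof.
rewrite /connection_mx (bigD1 a)//= big1 ?addr0 => [|c ca].
  by rewrite mxE !eqxx scale1r.
by rewrite mxE eqxx/= (negbTE ca) scale0r.
Qed.

Lemma covE X Y x : cov G X Y x = 'D_(X x) Y x + Y x *m connection_mx (X x) x.
Proof.
rewrite /cov; congr (_ + _); apply/rowP => k; rewrite !mxE exchange_big/=.
apply: eq_bigr => j _; rewrite summxE mulr_sumr; apply: eq_bigr => i _.
by rewrite !mxE; ring.
Qed.

Lemma metric_unit x : U x -> G x \in unitmx.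
Proof. by move=> /pG/posdef_unit. Qed.

Lemma metric_tr x : U x -> (G x)^T = G x.
Proof. by move=> /pG[]. Qed.

Lemma derive_sym v x (Q : E -> 'M[R]_n) : U x -> smooth_on U Q ->
  (forall y, U y -> (Q y)^T = Q y) -> ('D_v Q x)^T = 'D_v Q x.
Proof.
move=> Ux SQ sQ; rewrite -(derive_trmx oU v Ux SQ).
exact: (derive_eq_on oU v Ux sQ).
Qed.

Lemma derive_symE v i j x : U x -> 'D_v G x i j = 'D_v G x j i.
Proof.
move=> Ux; have /matrixP/(_ i j) := derive_sym v Ux SG metric_tr.
by rewrite [LHS]mxE => ->.
Qed.

Lemma christoffelE x a b c : U x -> christoffel G x a b c =
  2^-1 * \sum_l invmx (G x) c l *
    ('D_(basis a) G x b l + 'D_(basis b) G x a l - 'D_(basis l) G x a b).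
Proof.
move=> Ux; rewrite /christoffel; congr (_ * _); apply: eq_bigr => l _.
by rewrite !(derive_entry _ Ux).
Qed.

Lemma christoffel_sym x a b c : U x -> christoffel G x a b c = christoffel G x b a c.
Proof.
move=> Ux; rewrite !christoffelE//; congr (_ * _); apply: eq_bigr => l _.
have [D DE] : exists D, forall v, 'D_v G x = D v by exists (fun v => 'D_v G x).
have sD v i j : D v i j = D v j i by rewrite -DE derive_symE.
by rewrite !DE (sD _ a b); congr (_ * (_ - _)); exact: addrC.
Qed.

(** The connection has no torsion. *)
Lemma connection_mx_swap x v w : U x -> w *m connection_mx v x = v *m connection_mx w x.
Proof.
move=> Ux; apply/rowP => k; rewrite !mxE.
under eq_bigr do rewrite summxE mulr_sumr.
under [RHS]eq_bigr do rewrite summxE mulr_sumr.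
rewrite exchange_big/=; apply: eq_bigr => i _; apply: eq_bigr => j _.
by rewrite !mxE (christoffel_sym _ _ _ Ux) mulrCA.
Qed.

Lemma christoffel_mx_metric x a b c : U x -> (christoffel_mx a x *m G x) b c =
  2^-1 * ('D_(basis a) G x b c + 'D_(basis b) G x a c - 'D_(basis c) G x a b).
Proof.
move=> Ux; rewrite mxE.
under eq_bigr do rewrite mxE christoffelE// -mulrA mulr_suml.
rewrite -mulr_sumr exchange_big/=; congr (_ * _).
transitivity (\sum_l (invmx (G x) *m G x) l c *
    ('D_(basis a) G x b l + 'D_(basis b) G x a l - 'D_(basis l) G x a b)).
  apply: eq_bigr => l _; rewrite mxE mulr_suml; apply: eq_bigr => k _.
  have sI : invmx (G x) k l = invmx (G x) l k.
    by rewrite -[in LHS](metric_tr Ux) -trmx_inv mxE.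
  by rewrite sI mulrAC.
rewrite mulVmx ?metric_unit// (bigD1 c)//= big1 ?addr0 => [|l lc].
  by rewrite mxE eqxx mul1r.
by rewrite mxE (negbTE lc) mul0r.
Qed.

Lemma metric_compat x a : U x ->
  'D_(basis a) G x = christoffel_mx a x *m G x + G x *m (christoffel_mx a x)^T.
Proof.
move=> Ux; apply/matrixP => b c; rewrite mxE christoffel_mx_metric//.
have -> : (G x *m (christoffel_mx a x)^T) b c = (christoffel_mx a x *m G x) c b.
  transitivity ((christoffel_mx a x *m G x)^T b c); last by rewrite [LHS]mxE.
  by rewrite trmx_mul metric_tr.
rewrite christoffel_mx_metric//.
have [D DE] : exists D, forall v, 'D_v G x = D v by exists (fun v => 'D_v G x).
have sD v i j : D v i j = D v j i by rewrite -DE derive_symE.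
by rewrite !DE (sD _ c b); field.
Qed.

Lemma smooth_christoffel_mx a : smooth_on U (christoffel_mx a).
Proof.
apply/smooth_mxP => // b c k.
have C : Ck_on k U (fun x => 2^-1 * \sum_l invmx (G x) c l *
    ('D_(basis a) G x b l + 'D_(basis b) G x a l - 'D_(basis l) G x a b)).
  have SD e i j : Ck_on k U (fun x => 'D_(basis e) G x i j).
    exact: (smooth_entry oU i j (smooth_derive (basis e) SG) k).
  apply: (Ck_mul oU); first exact: (@Ck_cst R n R).
  apply: (@Ck_sum R n R k U _ _ _ _ oU) => l _; apply: (Ck_mul oU).
    exact: (smooth_entry oU c l (smooth_invmx oU metric_unit SG) k).
  apply: (@Ck_add R n R _ _ _ _ oU); last exact: (@Ck_opp R n R _ _ _ oU).
  exact: (@Ck_add R n R _ _ _ _ oU).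
by apply: Ck_eq C => // x Ux; rewrite mxE christoffelE.
Qed.

Lemma smooth_connection_mx w : smooth_on U (connection_mx w).
Proof.
move=> k; apply: (@Ck_sum R n 'M[R]_n k U _ _ _ (fun a x => w 0 a *: christoffel_mx a x) oU) => a _.
apply/(Ck_mxP _ _ oU) => i j.
have C : Ck_on k U (fun x => w 0 a * christoffel_mx a x i j).
  apply: (Ck_mul oU); first exact: (@Ck_cst R n R).
  exact: (smooth_entry oU i j (@smooth_christoffel_mx a) k).
by apply: Ck_eq C => // x _; rewrite [RHS]mxE.
Qed.

(** For the Christoffel matrices this is R(e_c, e_a). Endomorphisms act on row
    vectors from the right, so products are in the reverse order. *)
Definition curvature_mx (A : 'I_n -> E -> 'M[R]_n) c a x : 'M[R]_n :=
  'D_(basis c) (A a) x - 'D_(basis a) (A c) x + A a x *m A c x - A c x *m A a x.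

(** The symmetry of second derivatives of T: for T = G it says that the curvature
    is skew, and for a parallel endomorphism T that it commutes with T. *)
Lemma integrability (A B : 'I_n -> E -> 'M[R]_n) (T : E -> 'M[R]_n) c a x : U x ->
  smooth_on U T -> (forall e, smooth_on U (A e)) -> (forall e, smooth_on U (B e)) ->
  (forall e y, U y -> 'D_(basis e) T y = A e y *m T y + T y *m B e y) ->
  curvature_mx A c a x *m T x = T x *m ('D_(basis a) (B c) x - 'D_(basis c) (B a) x
    + B a x *m B c x - B c x *m B a x).
Proof.
move=> Ux ST SA SB DT.
have D2 e f : 'D_(basis f) ('D_(basis e) T) x =
    'D_(basis f) (A e) x *m T x + A e x *m (A f x *m T x + T x *m B f x)
    + ((A f x *m T x + T x *m B f x) *m B e x + T x *m 'D_(basis f) (B e) x).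
  rewrite (derive_eq_on oU _ Ux (DT e)).
  rewrite (derive_add _ Ux); [|exact: smooth_mulmx..].
  by rewrite !(derive_mulmx oU _ Ux)// DT.
have := Schwarz_mx oU (basis a) (basis c) Ux ST.
move=> S; have {S} := etrans (esym (D2 a c)) (etrans S (D2 c a)); rewrite /curvature_mx.
generalize ('D_(basis c) (A a) x) ('D_(basis a) (A c) x)
  ('D_(basis c) (B a) x) ('D_(basis a) (B c) x) => Aca Aac Bca Bac.
move: (A a x) (A c x) (B a x) (B c x) (T x) => Aa Ac Ba Bc X.
rewrite !mulmxDl !mulmxDr !mulmxN !mulNmx !mulmxA.
move: (Aca *m X) (Aac *m X) (X *m Bca) (X *m Bac) (Aa *m Ac *m X) (Ac *m Aa *m X)
  (Aa *m X *m Bc) (Ac *m X *m Ba) (X *m Bc *m Ba) (X *m Ba *m Bc).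
move=> m1 m2 m3 m4 m5 m6 m7 m8 m9 m10 /matrixP E.
by apply/matrixP => i j; move: (E i j); rewrite !mxE; lra.
Qed.

(** The endomorphism R(xi, e_a). *)
Definition xi_curvature a x : 'M[R]_n := \sum_c xi x 0 c *: curvature_mx christoffel_mx c a x.

(** The endomorphism X |-> nabla_X xi. *)
Definition cov_mx x : 'M[R]_n :=
  \matrix_(b, c) ('D_(basis b) xi x + xi x *m christoffel_mx b x) 0 c.

Lemma row_cov_mx b x : basis b *m cov_mx x = 'D_(basis b) xi x + xi x *m christoffel_mx b x.
Proof. by rewrite /basis -rowE; apply/rowP => c; rewrite [LHS]mxE [LHS]mxE. Qed.

Lemma smooth_cov_mx : smooth_on U cov_mx.
Proof.
apply/(smooth_mxP oU) => b c.
have S : smooth_on U (fun x => 'D_(basis b) xi x + xi x *m christoffel_mx b x).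
  apply: smooth_add => //; first exact: smooth_derive.
  by apply: smooth_mulmx => //; exact: smooth_christoffel_mx.
by move=> k; apply: Ck_eq (smooth_entry oU 0 c S k) => // x _; rewrite [RHS]mxE.
Qed.

Definition nabla_cov_mx a x : 'M[R]_n :=
  'D_(basis a) cov_mx x + cov_mx x *m christoffel_mx a x - christoffel_mx a x *m cov_mx x.

Lemma derive_connection_mx v w x : U x ->
  'D_v (connection_mx w) x = \sum_c w 0 c *: 'D_v (christoffel_mx c) x.
Proof.
move=> Ux; have -> : connection_mx w = \sum_c w 0 c *: christoffel_mx c.
  by apply/funext => y; rewrite /connection_mx fct_sumE.
have d c : derivable (christoffel_mx c) x v by exact: smooth_derivable (@smooth_christoffel_mx c) Ux.
rewrite derive_sum => [|c]; last exact: derivableZ.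
by apply: eq_bigr => c _; rewrite deriveZ.
Qed.

Lemma derive_cstmul p q (A : 'M[R]_(p, q)) m (f : E -> 'M[R]_(q, m)) v x : U x -> smooth_on U f ->
  'D_v (fun y => A *m f y) x = A *m 'D_v f x.
Proof.
move=> Ux Sf; rewrite (derive_mulmx oU v Ux (smooth_cst U A) Sf).
by rewrite derive_cst mul0mx add0r.
Qed.

Lemma derive_christoffel_mx_swap a b w x : U x ->
  w *m 'D_(basis a) (christoffel_mx b) x = basis b *m \sum_c w 0 c *: 'D_(basis a) (christoffel_mx c) x.
Proof.
move=> Ux.
have e1 := derive_cstmul w (basis a) Ux (@smooth_christoffel_mx b).
have e2 := derive_cstmul (basis b) (basis a) Ux (@smooth_connection_mx w).
rewrite (derive_connection_mx _ _ Ux) in e2.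
apply: (etrans (esym e1)); apply: (etrans _ e2).
by apply: (derive_eq_on oU (basis a) Ux) => y Uy; rewrite -connection_mx_basis connection_mx_swap.
Qed.

Lemma connection_mxN w x : connection_mx (- w) x = - connection_mx w x.
Proof. by rewrite /connection_mx -sumrN; apply: eq_bigr => c _; rewrite mxE scaleNr. Qed.

Lemma xi_curvatureE a x : xi_curvature a x =
  \sum_c xi x 0 c *: 'D_(basis c) (christoffel_mx a) x - \sum_c xi x 0 c *: 'D_(basis a) (christoffel_mx c) x
  + christoffel_mx a x *m connection_mx (xi x) x - connection_mx (xi x) x *m christoffel_mx a x.
Proof.
rewrite /xi_curvature /curvature_mx /connection_mx mulmx_sumr mulmx_suml -!sumrN -!big_split/=.
apply: eq_bigr => c _.
by rewrite -scalemxAr -scalemxAl !scalerDr !scalerN.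
Qed.

(** The terms of (L_xi nabla)(e_a, e_b) with second derivatives of xi are those of
    nabla_a (nabla xi); what remains is of first order in the Christoffel symbols
    and assembles into the curvature. *)
Lemma lie_connectionE a b x : U x ->
  lie_connection G xi (fun=> basis a) (fun=> basis b) x
  = basis b *m (nabla_cov_mx a x + xi_curvature a x).
Proof.
move=> Ux.
have covc c : cov G (fun=> basis a) (fun=> basis c) = fun y => basis c *m christoffel_mx a y.
  by apply/funext => y; rewrite covE derive_cst add0r connection_mx_basis.
have br c : bracket xi (fun=> basis c) = fun y => - 'D_(basis c) xi y.
  by apply/funext => y; rewrite /bracket derive_cst sub0r.
have SD c : smooth_on U ('D_(basis c) xi) by exact: smooth_derive.
have SG' c : smooth_on U (christoffel_mx c) by exact: smooth_christoffel_mx.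
rewrite /lie_connection covc !br {1}/bracket !covE derive_cst add0r connection_mx_basis.
rewrite derive_cstmul// (derive_opp _ Ux)//.
rewrite (derive_lin_mx oU (xi x) Ux (SG' a)).
rewrite (derive_lin_mx oU (basis b *m christoffel_mx a x) Ux Sxi).
rewrite connection_mxN mulmxN.
have DP : basis b *m 'D_(basis a) cov_mx x = 'D_(basis a) ('D_(basis b) xi) x
   + ('D_(basis a) xi x *m christoffel_mx b x + xi x *m 'D_(basis a) (christoffel_mx b) x).
  rewrite -derive_cstmul//; last exact: smooth_cov_mx.
  have -> : (fun y => basis b *m cov_mx y) = (fun y => 'D_(basis b) xi y + xi y *m christoffel_mx b y).
    by apply/funext => y; exact: row_cov_mx.
  rewrite (derive_add _ Ux (SD b)); last exact: smooth_mulmx.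
  by rewrite (derive_mulmx oU _ Ux).
rewrite /nabla_cov_mx !mulmxDr mulmxN DP !mulmxA row_cov_mx mulmxDl.
have GP : basis b *m christoffel_mx a x *m cov_mx x = \sum_c (basis b *m christoffel_mx a x) 0 c *: 'D_(basis c) xi x
    + basis b *m christoffel_mx a x *m connection_mx (xi x) x.
  rewrite -[X in _ = _ + X](connection_mx_swap _ _ Ux).
  rewrite {1}(row_sum_delta (basis b *m christoffel_mx a x)) mulmx_suml.
  rewrite /connection_mx mulmx_sumr -big_split/=; apply: eq_bigr => c _.
  by rewrite -scalemxAl row_cov_mx scalerDr scalemxAr.
have dS := derive_christoffel_mx_swap a b (xi x) Ux.
have XGG : xi x *m christoffel_mx b x *m christoffel_mx a x =
    basis b *m connection_mx (xi x) x *m christoffel_mx a x.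
  by rewrite -connection_mx_basis connection_mx_swap.
have aG : 'D_(basis a) xi x *m christoffel_mx b x = basis b *m connection_mx ('D_(basis a) xi x) x.
  by rewrite -connection_mx_basis connection_mx_swap.
have bS := congr1 (mulmx (basis b)) (xi_curvatureE a x).
rewrite !mulmxDr !mulmxN !mulmxA in bS.
rewrite mulNmx; exact: (lie_cancel _ _ aG XGG GP dS bS).
Qed.

(** The exterior derivative of the dual form is the skew part of nabla xi, because
    the connection is metric and has no torsion. *)
Lemma d_dual_basis a b x : U x ->
  d_dual G xi (fun=> basis a) (fun=> basis b) x = (cov_mx x *m G x) a b - (cov_mx x *m G x) b a.
Proof.
move=> Ux; rewrite /d_dual.
have -> : bracket (fun=> basis a) (fun=> basis b) x = 0 :> E.
  by rewrite /bracket !derive_cst subrr.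
rewrite {3}/form trmx0 mulmx0 [X in _ - X]mxE subr0.
have SxG : smooth_on U (fun y => xi y *m G y) by exact: smooth_mulmx.
have DxG e : 'D_(basis e) (fun y => xi y *m G y) x =
    basis e *m (cov_mx x *m G x) + xi x *m G x *m (christoffel_mx e x)^T.
  rewrite (derive_mulmx oU _ Ux)// metric_compat// mulmxA row_cov_mx mulmxDl mulmxDr !mulmxA.
  by rewrite addrA.
have E1 e f : 'D_(basis e) (fun y => form (G y) (xi y) (basis f)) x =
    (cov_mx x *m G x) e f + (basis f *m christoffel_mx e x *m (xi x *m G x)^T) 0 0.
  have -> : (fun y => form (G y) (xi y) (basis f)) = (fun y => (xi y *m G y) 0 f).
    by apply/funext => y; exact: form_basis.
  rewrite (derive_entry (basis e) Ux 0 f SxG) DxG mxE; congr (_ + _).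
    by rewrite /basis -rowE [LHS]mxE.
  transitivity ((christoffel_mx e x *m (xi x *m G x)^T) f 0).
    by rewrite -[in RHS](trmxK (christoffel_mx e x)) -trmx_mul [RHS]mxE.
  by rewrite -mulmxA /basis -rowE [RHS]mxE.
rewrite !E1 -(connection_mx_basis a) -(connection_mx_basis b) (connection_mx_swap _ _ Ux).
by rewrite opprD addrACA subrr addr0.
Qed.

Definition differential x : E := \row_l 'D_(basis l) r x.

(** The endomorphism Y |-> Y(rho) e_a - g(e_a, Y) nabla rho. *)
Definition affine_curvature a x : 'M[R]_n :=
  (differential x)^T *m basis a - (basis a *m G x)^T *m (differential x *m invmx (G x)).

Definition closed_on := forall x a b, U x ->
  d_dual G xi (fun=> basis a) (fun=> basis b) x = 0.

Definition affine_on := forall x a b, U x ->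
  lie_connection G xi (fun=> basis a) (fun=> basis b) x
  = 'D_(basis a) r x *: basis b + 'D_(basis b) r x *: basis a
    - form (G x) (basis a) (basis b) *: gradient G r x.

Lemma cov_mx_sym : closed_on -> forall x, U x -> selfadjoint (G x) (cov_mx x).
Proof.
move=> cl x Ux; apply/matrixP => a b; rewrite [LHS]mxE.
by have := cl x a b Ux; rewrite d_dual_basis// => /eqP; rewrite subr_eq0 => /eqP.
Qed.

Hypothesis cl : closed_on.
Hypothesis af : affine_on.

(** The affine conformal equation, read as an equation between endomorphisms. *)
Lemma affine_mx a x : U x ->
  nabla_cov_mx a x + xi_curvature a x = ('D_(basis a) r x)%:M + affine_curvature a x.
Proof.
move=> Ux; apply: eq_mx_basis => b; rewrite -lie_connectionE// af//.
rewrite mulmxDr mul_mx_scalar -addrA; congr (_ + _).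
rewrite /affine_curvature mulmxBr !mulmxA; congr (_ - _).
  have -> : basis b *m (differential x)^T = ('D_(basis b) r x)%:M.
    by apply/matrixP => i j; rewrite !ord1 /basis -rowE !mxE eqxx mulr1n.
  by rewrite mul_scalar_mx.
have -> : basis b *m (basis a *m G x)^T = (form (G x) (basis a) (basis b))%:M.
  apply/matrixP => i j; rewrite !ord1 form_basis /basis -rowE [LHS]mxE [LHS]mxE.
  by rewrite [RHS]mxE eqxx mulr1n.
by rewrite mul_scalar_mx -scalemxAl.
Qed.

Lemma curvature_mx_skew c a x : U x ->
  curvature_mx christoffel_mx c a x *m G x + G x *m (curvature_mx christoffel_mx c a x)^T = 0.
Proof.
move=> Ux.
have ST e : smooth_on U (fun y => (christoffel_mx e y)^T) by apply: smooth_trmx => //; exact: smooth_christoffel_mx.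
have I := integrability c a Ux SG smooth_christoffel_mx ST (fun e y Uy => metric_compat e Uy).
rewrite I -mulmxDr /curvature_mx !(derive_trmx oU _ Ux (@smooth_christoffel_mx _)) -!trmx_mul.
by rewrite trmx_alternating antisym_cancel mulmx0.
Qed.

Lemma xi_curvature_skew a x : U x ->
  (xi_curvature a x *m G x)^T = - (xi_curvature a x *m G x).
Proof.
move=> Ux; rewrite /xi_curvature mulmx_suml -sumrN [LHS]linear_sum; apply: eq_bigr => c _ /=.
rewrite -scalemxAl linearZ/= trmx_mul metric_tr// -scalerN; congr (_ *: _).
by apply/eqP; rewrite -addr_eq0 addrC; apply/eqP; exact: curvature_mx_skew.
Qed.

Lemma affine_curvature_skew a x : U x -> (affine_curvature a x *m G x)^T = - (affine_curvature a x *m G x).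
Proof.
move=> Ux; rewrite /affine_curvature mulmxBl.
have -> : (basis a *m G x)^T *m (differential x *m invmx (G x)) *m G x = (basis a *m G x)^T *m differential x.
  by rewrite mulmxA mulmxKV ?metric_unit.
rewrite -(mulmxA _ (basis a)) linearB/= !trmx_mul !trmxK opprB metric_tr//.
Qed.

Lemma nabla_cov_mx_sym a x : U x -> (nabla_cov_mx a x *m G x)^T = nabla_cov_mx a x *m G x.
Proof.
move=> Ux; have SPG : smooth_on U (fun y => cov_mx y *m G y).
  by apply: smooth_mulmx => //; exact: smooth_cov_mx.
have sPG := cov_mx_sym cl.
have D := derive_mulmx oU (basis a) Ux smooth_cov_mx SG.
have sD := derive_sym (basis a) Ux SPG sPG.
have -> : nabla_cov_mx a x *m G x = 'D_(basis a) (fun y => cov_mx y *m G y) x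
    - (cov_mx x *m G x *m (christoffel_mx a x)^T + christoffel_mx a x *m (cov_mx x *m G x)).
  rewrite D metric_compat// /nabla_cov_mx mulmxBl mulmxDl mulmxDr !mulmxA.
  exact: nabla_cancel.
rewrite linearB/= sD linearD/= !trmx_mul trmxK -trmx_mul sPG//.
by rewrite (addrC (christoffel_mx a x *m _)).
Qed.

Lemma nabla_cov_mx_scalar a x : U x ->
  nabla_cov_mx a x = ('D_(basis a) r x)%:M /\ xi_curvature a x = affine_curvature a x.
Proof.
move=> Ux; have A := affine_mx a Ux.
have sN := nabla_cov_mx_sym a Ux; have sS := xi_curvature_skew a Ux; have sT := affine_curvature_skew a Ux.
have Gu := metric_unit Ux; have sG := metric_tr Ux.
exact: sym_skew_split sG Gu sN sS sT A.
Qed.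

(** Half of the tensor H. *)
Definition parallel_part x : 'M[R]_n := cov_mx x - (r x)%:M.

Lemma smooth_parallel_part : smooth_on U parallel_part.
Proof.
apply: smooth_add => //; first exact: smooth_cov_mx.
by apply: smooth_opp => //; exact: smooth_scalar_mx.
Qed.

Lemma derive_cov_mx a x : U x ->
  'D_(basis a) cov_mx x =
    ('D_(basis a) r x)%:M + christoffel_mx a x *m cov_mx x - cov_mx x *m christoffel_mx a x.
Proof.
move=> Ux; have [N _] := nabla_cov_mx_scalar a Ux.
by rewrite -N /nabla_cov_mx subrK addrK.
Qed.

Lemma derive_parallel_part a x : U x ->
  'D_(basis a) parallel_part x =
    christoffel_mx a x *m parallel_part x - parallel_part x *m christoffel_mx a x.
Proof.
move=> Ux; have SM := smooth_scalar_mx oU Sr.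
rewrite (derive_add _ Ux smooth_cov_mx (smooth_opp oU SM)) (derive_opp _ Ux SM).
rewrite (derive_scalar_mx oU _ Ux Sr) derive_cov_mx// mulmxBr mulmxBl scalar_mxC.
exact: scalar_cancel.
Qed.

Lemma xi_curvature_comm a x : U x ->
  xi_curvature a x *m parallel_part x = parallel_part x *m xi_curvature a x.
Proof.
move=> Ux; rewrite /xi_curvature mulmx_suml mulmx_sumr; apply: eq_bigr => c _.
rewrite -scalemxAl -scalemxAr; congr (_ *: _).
have SN e : smooth_on U (fun y => - christoffel_mx e y) by apply: smooth_opp => //; exact: smooth_christoffel_mx.
have DH e y : U y -> 'D_(basis e) parallel_part y =
    christoffel_mx e y *m parallel_part y + parallel_part y *m - christoffel_mx e y.
  by move=> Uy; rewrite mulmxN derive_parallel_part.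
rewrite (integrability c a Ux smooth_parallel_part smooth_christoffel_mx SN DH); congr (_ *m _).
apply: curvature_opp; exact: (derive_opp _ Ux (@smooth_christoffel_mx _)).
Qed.

Lemma parallel_part_selfadjoint x : U x -> selfadjoint (G x) (parallel_part x).
Proof.
move=> Ux; rewrite /selfadjoint /parallel_part mulmxBl linearB/= cov_mx_sym//.
by rewrite mul_scalar_mx linearZ/= metric_tr.
Qed.

Lemma parallel_part_scalar x : (0 < n)%N -> U x -> differential x != 0 ->
  parallel_part x = (\tr (parallel_part x) / n%:R)%:M.
Proof.
move=> n0 Ux d0; apply: (scalar_of_commute n0 (pG Ux) (parallel_part_selfadjoint Ux) d0) => a /=.
have [_ S] := nabla_cov_mx_scalar a Ux.
have := xi_curvature_comm a Ux; rewrite S; exact.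
Qed.

Lemma derive_tr_parallel_part a x : U x -> 'D_(basis a) (fun y => \tr (parallel_part y)) x = 0.
Proof.
move=> Ux; rewrite (derive_mxtrace oU _ Ux smooth_parallel_part) derive_parallel_part//.
exact: mxtrace_commutator.
Qed.

(** A commutator has trace zero. *)
Lemma derive_trace_sqr (N : E -> 'M[R]_n) a x : U x -> smooth_on U N ->
  'D_(basis a) N x = christoffel_mx a x *m N x - N x *m christoffel_mx a x ->
  'D_(basis a) (fun y => \tr (N y *m N y)) x = 0.
Proof.
move=> Ux SN DN.
rewrite (derive_mxtrace oU _ Ux (smooth_mulmx oU SN SN)) (derive_mulmx oU _ Ux)// DN.
have -> : (christoffel_mx a x *m N x - N x *m christoffel_mx a x) *m N x
    + N x *m (christoffel_mx a x *m N x - N x *m christoffel_mx a x)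
    = christoffel_mx a x *m (N x *m N x) - (N x *m N x) *m christoffel_mx a x.
  by rewrite mulmxBl mulmxBr !mulmxA addrA subrK.
exact: mxtrace_commutator.
Qed.

Definition tracefree_part x : 'M[R]_n := cov_mx x - (\tr (cov_mx x) / n%:R)%:M.

Lemma tracefree_partE x : (0 < n)%N ->
  tracefree_part x = parallel_part x - (\tr (parallel_part x) / n%:R)%:M.
Proof.
move=> n0; have nN0 : n%:R != 0 :> R by rewrite pnatr_eq0 -lt0n.
rewrite /tracefree_part /parallel_part linearB/= mxtrace_scalar.
have -> : (\tr (cov_mx x) - r x *+ n) / n%:R = \tr (cov_mx x) / n%:R - r x.
  by rewrite -mulr_natr; field.
by apply/matrixP => i j; rewrite !mxE; case: (i == j); rewrite ?mulr1n ?mulr0n; ring.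
Qed.

Lemma smooth_tracefree_part : smooth_on U tracefree_part.
Proof.
apply: smooth_add => //; first exact: smooth_cov_mx.
apply: smooth_opp => //; apply: smooth_scalar_mx => // k.
apply: (Ck_mul oU); first exact: smooth_mxtrace smooth_cov_mx k.
exact: (@Ck_cst R n R).
Qed.

Lemma derive_tr_tracefree_sqr a x : (0 < n)%N -> U x ->
  'D_(basis a) (fun y => \tr (tracefree_part y *m tracefree_part y)) x = 0.
Proof.
move=> n0 Ux; apply: derive_trace_sqr => //; first exact: smooth_tracefree_part.
have SH := smooth_parallel_part.
have St : smooth_on U (fun y => \tr (parallel_part y) / n%:R).
  move=> k; apply: (Ck_mul oU); first exact: smooth_mxtrace SH k.
  exact: (@Ck_cst R n R).
have SM := smooth_scalar_mx oU St.
have e1 := derive_add (basis a) Ux SH (smooth_opp oU SM).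
have e2 := derive_opp (basis a) Ux SM.
have e3 := derive_scalar_mx oU (basis a) Ux St.
have e4 : 'D_(basis a) (fun y => \tr (parallel_part y) / n%:R) x = 0.
  have St' : smooth_on U (fun y => \tr (parallel_part y)) by exact: smooth_mxtrace.
  apply: (etrans (derive_mulr (basis a) Ux St' (smooth_cst U (n%:R^-1 : R)))).
  by rewrite derive_tr_parallel_part// derive_cst mulr0 mul0r addr0.
have tE : tracefree_part = fun y => parallel_part y - (\tr (parallel_part y) / n%:R)%:M.
  by apply/funext => y; exact: tracefree_partE.
have e5 := derive_parallel_part a Ux.
have e6 : 'D_(basis a) tracefree_part x = 'D_(basis a) parallel_part x.
  rewrite tE; apply: (etrans e1); rewrite e2 e3 e4.
  by apply/matrixP => i j; rewrite !mxE mul0rn subr0.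
apply: (etrans e6); apply: (etrans e5).
rewrite (tracefree_partE x n0); exact: commutator_shift.
Qed.

End LocalGeometry.

(** * The Lie derivative of the metric, and the maxima of |xi|^2 *)

Section Energy.
Context {R : realType} {n : nat}.
Local Notation E := 'rV[R]_n.
Variables (U : set E) (G : E -> 'M[R]_n) (xi : E -> E).
Hypothesis oU : open U.
Hypothesis SG : smooth_on U G.
Hypothesis pG : forall x, U x -> posdef (G x).
Hypothesis Sxi : smooth_on U xi.
Hypothesis cl : closed_on U G xi.
Implicit Types (x y u v w : E) (a b c : 'I_n).

Local Notation cov_mx := (cov_mx G xi).
Let compat := metric_compat oU SG pG.
Let metric_tr x Ux := metric_tr pG (x := x) Ux.

Lemma mul_cov_mx u x : U x -> u *m cov_mx x = 'D_u xi x + u *m connection_mx G (xi x) x.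
Proof.
move=> Ux; rewrite (derive_lin_mx oU u Ux Sxi) (connection_mx_swap oU SG pG _ _ Ux).
rewrite {1}(row_sum_delta u) mulmx_suml /connection_mx mulmx_sumr -big_split/=.
by apply: eq_bigr => c _; rewrite -scalemxAl -/(basis c) row_cov_mx scalerDr scalemxAr.
Qed.

Lemma derive_metric v x : U x ->
  'D_v G x = connection_mx G v x *m G x + G x *m (connection_mx G v x)^T.
Proof.
move=> Ux; rewrite (derive_lin_mx oU v Ux SG) /connection_mx [X in G x *m X]linear_sum.
rewrite mulmx_suml mulmx_sumr -big_split/=; apply: eq_bigr => c _.
by rewrite compat// scalerDr scalemxAl linearZ/= scalemxAr.
Qed.

Lemma lie_metric_algebra (X Y dX dY wX wY : 'rV[R]_n) (g A : 'M[R]_n) :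
  ((dX *m g + X *m (A *m g + g *m A^T)) *m Y^T + X *m g *m dY^T) 0 0
    - form g (dX - wX) Y - form g X (dY - wY)
  = ((wX + X *m A) *m g *m Y^T + X *m g *m (wY + Y *m A)^T) 0 0.
Proof.
rewrite /form trmx_sub trmx_add trmx_mul !(mulmxDl, mulmxDr, mulNmx, mulmxN) !mulmxA.
move: (dX *m g *m Y^T) (X *m A *m g *m Y^T) (X *m g *m A^T *m Y^T)
  (X *m g *m dY^T) (wX *m g *m Y^T) (X *m g *m wY^T) => *.
by rewrite !mxE; ring.
Qed.

(** As nabla xi is self-adjoint, both of its contributions to L_xi g agree. *)
Lemma lie_metricE X Y x : U x -> smooth_on U X -> smooth_on U Y ->
  lie_metric G xi X Y x = 2 * (X x *m (cov_mx x *m G x) *m (Y x)^T) 0 0.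
Proof.
move=> Ux SX SY; rewrite /lie_metric.
have SXG := smooth_mulmx oU SX SG.
have SYT := smooth_trmx oU SY.
have SXGY := smooth_mulmx oU SXG SYT.
rewrite (derive_entry (xi x) Ux 0 0 SXGY).
rewrite (derive_mulmx oU _ Ux SXG SYT) (derive_mulmx oU _ Ux SX SG) (derive_trmx oU _ Ux SY).
have -> : X x *m (cov_mx x *m G x) *m (Y x)^T = X x *m cov_mx x *m G x *m (Y x)^T by rewrite !mulmxA.
have sP : cov_mx x *m G x = G x *m (cov_mx x)^T.
  by rewrite -{1}(cov_mx_sym oU SG pG Sxi cl Ux) trmx_mul metric_tr.
have -> : 2 * (X x *m cov_mx x *m G x *m (Y x)^T) 0 0 =
    (X x *m cov_mx x *m G x *m (Y x)^T + X x *m G x *m (Y x *m cov_mx x)^T) 0 0.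
  by rewrite [RHS]mxE trmx_mul !mulmxA -(mulmxA (X x) (G x)) -sP !mulmxA; ring.
rewrite (mul_cov_mx (X x) Ux) (mul_cov_mx (Y x) Ux) (derive_metric _ Ux).
exact: lie_metric_algebra.
Qed.

Definition energy y : R := form (G y) (xi y) (xi y).

Lemma smooth_energy : smooth_on U energy.
Proof.
exact: smooth_entry (smooth_mulmx oU (smooth_mulmx oU Sxi SG) (smooth_trmx oU Sxi)).
Qed.

Lemma energy_algebra (X e : 'rV[R]_n) (g p A : 'M[R]_n) :
  (((e *m p - X *m A) *m g + X *m (A *m g + g *m A^T)) *m X^T
     + X *m g *m (e *m p - X *m A)^T)
  = e *m (p *m g) *m X^T + X *m g *m (e *m p)^T.
Proof.
rewrite trmx_sub !trmx_mul !(mulmxDl, mulmxDr, mulNmx, mulmxN) !mulmxA.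
move: (e *m p *m g *m X^T) (X *m A *m g *m X^T) (X *m g *m A^T *m X^T) (X *m g *m p^T *m e^T) => *.
by apply/matrixP => i j; rewrite !mxE; ring.
Qed.

Lemma derive_xi a x : 'D_(basis a) xi x = basis a *m cov_mx x - xi x *m christoffel_mx G a x.
Proof. by rewrite row_cov_mx addrK. Qed.

(** This is g(nabla_a xi, xi). *)
Definition half_slope a y : R := (basis a *m (cov_mx y *m G y) *m (xi y)^T) 0 0.

Lemma derive_energy a x : U x -> 'D_(basis a) energy x = 2 * half_slope a x.
Proof.
move=> Ux; have SxG := smooth_mulmx oU Sxi SG; have Sxt := smooth_trmx oU Sxi.
have SE := smooth_mulmx oU SxG Sxt.
apply: (etrans (derive_entry (basis a) Ux 0 0 SE)).
have e1 := derive_mulmx oU (basis a) Ux SxG Sxt.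
have e2 := derive_mulmx oU (basis a) Ux Sxi SG.
have e3 := derive_trmx oU (basis a) Ux Sxi.
rewrite e2 e3 (compat _ Ux) derive_xi energy_algebra in e1.
rewrite e1 [LHS]mxE /half_slope.
have -> : (xi x *m G x *m (basis a *m cov_mx x)^T) 0 0 = (basis a *m (cov_mx x *m G x) *m (xi x)^T) 0 0.
  transitivity ((xi x *m G x *m (basis a *m cov_mx x)^T)^T 0 0); first by rewrite [RHS]mxE.
  by rewrite !trmx_mul !trmxK (metric_tr Ux) !mulmxA.
by ring.
Qed.

Lemma half_slope_algebra (X e : 'rV[R]_n) (g p A : 'M[R]_n) :
  e *m ((A *m p - p *m A) *m g + p *m (A *m g + g *m A^T)) *m X^T
     + e *m (p *m g) *m (e *m p - X *m A)^T
  = e *m A *m (p *m g) *m X^T + e *m p *m g *m (e *m p)^T.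
Proof.
rewrite trmx_sub !trmx_mul !(mulmxDl, mulmxDr, mulNmx, mulmxN) !mulmxA.
move: (e *m A *m p *m g *m X^T) (e *m p *m A *m g *m X^T) (e *m p *m g *m A^T *m X^T)
  (e *m p *m g *m p^T *m e^T) => *.
by apply/matrixP => i j; rewrite !mxE; ring.
Qed.

Hypothesis DP : forall a y, U y ->
  'D_(basis a) cov_mx y = christoffel_mx G a y *m cov_mx y - cov_mx y *m christoffel_mx G a y.

Lemma derive_half_slope a x : U x -> 'D_(basis a) (half_slope a) x =
  (basis a *m christoffel_mx G a x *m (cov_mx x *m G x) *m (xi x)^T) 0 0
    + form (G x) (basis a *m cov_mx x) (basis a *m cov_mx x).
Proof.
move=> Ux; have SP := smooth_cov_mx oU SG pG Sxi.
have SPG := smooth_mulmx oU SP SG; have Sxt := smooth_trmx oU Sxi.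
have SeP := smooth_mulmx oU (smooth_cst U (basis a)) SPG.
have SE := smooth_mulmx oU SeP Sxt.
apply: (etrans (derive_entry (basis a) Ux 0 0 SE)).
have e1 := derive_mulmx oU (basis a) Ux SeP Sxt.
have e2 := derive_cstmul oU (basis a) (basis a) Ux SPG.
have e3 := derive_trmx oU (basis a) Ux Sxi.
have e4 := derive_mulmx oU (basis a) Ux SP SG.
rewrite e2 e3 e4 (compat _ Ux) (DP _ Ux) derive_xi half_slope_algebra in e1.
by rewrite e1 [LHS]mxE.
Qed.

(** At a maximum the gradient of |xi|^2 / 2 vanishes, which removes the Christoffel
    term from its second derivative along e_a; the remaining term is the squared
    length of nabla_a xi. *)
Lemma energy_max x : U x -> (forall y, U y -> energy y <= energy x) -> cov_mx x = 0.
Proof.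
move=> Ux xmax.
have slope0 a : half_slope a x = 0.
  have [+ _] := local_max_derive oU (basis a) Ux smooth_energy xmax.
  by rewrite derive_energy// => /eqP; rewrite mulf_eq0 pnatr_eq0/= => /eqP.
have PGx : cov_mx x *m G x *m (xi x)^T = 0.
  apply: eq_mx_basis => a; rewrite mulmx0 mulmxA; apply/matrixP => i j.
  by rewrite !ord1 [RHS]mxE; exact: slope0.
apply: eq_mx_basis => a; rewrite mulmx0.
have [_] := local_max_derive oU (basis a) Ux smooth_energy xmax.
have e1 : 'D_(basis a) ('D_(basis a) energy) x = 'D_(basis a) (fun y => 2 * half_slope a y) x.
  by apply: (derive_eq_on oU) => // y Uy; exact: derive_energy.
have Sh : smooth_on U (half_slope a).
  have SPG := smooth_mulmx oU (smooth_cov_mx oU SG pG Sxi) SG.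
  have SeP := smooth_mulmx oU (smooth_cst U (basis a)) SPG.
  exact: smooth_entry (smooth_mulmx oU SeP (smooth_trmx oU Sxi)).
have e2 := derive_mulr (basis a) Ux (smooth_cst U (2 : R)) Sh.
rewrite derive_cst mul0r add0r (derive_half_slope _ Ux) in e2.
have e3 := etrans e1 e2; rewrite -!mulmxA !(mulmxA (cov_mx x)) PGx !mulmx0 in e3.
rewrite (_ : (0 : 'M[R]_1) 0 0 = 0) ?add0r in e3; last by rewrite mxE.
rewrite e3 pmulr_rle0// => le0; apply/eqP/negP => /negP ne0.
have [_ posG] := pG Ux.
by move: (posG _ ne0); rewrite ltNge le0.
Qed.

End Energy.

(** * Change of charts *)

Section Jacobian.
Context {R : realType} {n : nat}.
Local Notation E := 'rV[R]_n.
Variables (U : set E).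
Hypothesis oU : open U.

Definition jacobian (t : E -> E) x : 'M[R]_n := \matrix_(a, b) 'D_(basis a) t x 0 b.

Lemma jacobian_row t a x : basis a *m jacobian t x = 'D_(basis a) t x.
Proof. by rewrite /basis -rowE; apply/rowP => b; rewrite !mxE. Qed.

Lemma jacobianE t u x : U x -> smooth_on U t -> 'D_u t x = u *m jacobian t x.
Proof.
move=> Ux St; rewrite (derive_lin_mx oU u Ux St) [in RHS](row_sum_delta u) mulmx_suml.
by apply: eq_bigr => c _; rewrite -scalemxAl -/(basis c) jacobian_row.
Qed.

Lemma smooth_jacobian t : smooth_on U t -> smooth_on U (jacobian t).
Proof.
move=> St; apply/(smooth_mxP oU) => a b k.
apply: (Ck_eq oU _ (smooth_entry oU 0 b (smooth_derive (basis a) St) k)) => x _.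
by rewrite [RHS]mxE.
Qed.

End Jacobian.

Section LieDerivativeMetric.
Context {R : realType} {n : nat}.
Local Notation E := 'rV[R]_n.
Variables (U : set E) (G : E -> 'M[R]_n) (xi : E -> E).
Hypothesis oU : open U.
Hypothesis SG : smooth_on U G.
Hypothesis pG : forall x, U x -> posdef (G x).
Hypothesis Sxi : smooth_on U xi.
Hypothesis cl : closed_on U G xi.

Lemma cov_mx_jacobian x : U x -> cov_mx G xi x = jacobian xi x + connection_mx G (xi x) x.
Proof.
move=> Ux; apply: eq_mx_basis => a.
by rewrite (mul_cov_mx oU SG pG Sxi _ Ux) mulmxDr jacobian_row.
Qed.

(** This form of L_xi g contains no Christoffel symbols, so its behaviour under a
    change of charts follows from that of the components of g and xi. *)
Lemma lie_metric_mx x : U x ->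
  'D_(xi x) G x + jacobian xi x *m G x + G x *m (jacobian xi x)^T = 2 *: (cov_mx G xi x *m G x).
Proof.
move=> Ux; rewrite scaler_nat mulr2n.
rewrite -[X in _ = _ + X](cov_mx_sym oU SG pG Sxi cl Ux) trmx_mul (metric_tr pG Ux).
rewrite cov_mx_jacobian// (derive_metric oU SG pG _ Ux) trmx_add mulmxDl mulmxDr.
move: (_ *m G x) (_ *m G x) (G x *m _) (G x *m _) => *.
by apply/matrixP => i j; rewrite !mxE; ring.
Qed.

End LieDerivativeMetric.

Section Naturality.
Context {R : realType} {n : nat}.
Local Notation E := 'rV[R]_n.
Variables (U V : set E) (G G' : E -> 'M[R]_n) (xi xi' : E -> E) (t : E -> E).
Hypothesis oU : open U.
Hypothesis oV : open V.
Hypothesis SG : smooth_on U G.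
Hypothesis pG : forall x, U x -> posdef (G x).
Hypothesis Sxi : smooth_on U xi.
Hypothesis cl : closed_on U G xi.
Hypothesis SG' : smooth_on V G'.
Hypothesis pG' : forall x, V x -> posdef (G' x).
Hypothesis Sxi' : smooth_on V xi'.
Hypothesis cl' : closed_on V G' xi'.
Hypothesis St : smooth_on U t.
Hypothesis tV : forall x, U x -> V (t x).
Local Notation T := (jacobian t).
Hypothesis Gt : forall x, U x -> G x = T x *m G' (t x) *m (T x)^T.
Hypothesis xit : forall x, U x -> xi' (t x) = xi x *m T x.

Lemma smooth_comp_mx p q (f : E -> 'M[R]_(p, q)) : smooth_on V f -> smooth_on U (f \o t).
Proof.
move=> Sf; apply/(smooth_mxP oU) => i j k.
exact: (Ck_comp oU oV tV (St k) (smooth_entry oV i j Sf k)).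
Qed.

Lemma derive_comp_mx p q (f : E -> 'M[R]_(p, q)) u x : U x -> smooth_on V f ->
  'D_u (f \o t) x = 'D_(u *m T x) f (t x).
Proof.
move=> Ux Sf; rewrite -(jacobianE oU u Ux St); apply: derive_comp.
  exact: Ck_mx_differentiable oU (St 1) Ux.
exact: Ck_mx_differentiable oV (Sf 1) (tV Ux).
Qed.

(** The derivative of the transformation law of xi. *)
Lemma jacobian_xi x : U x ->
  T x *m jacobian xi' (t x) = jacobian xi x *m T x + 'D_(xi x) T x.
Proof.
move=> Ux; have ST := smooth_jacobian oU St.
have DT w v : w *m 'D_v T x = 'D_v ('D_w t) x.
  apply: (etrans (esym (derive_cstmul oU w v Ux ST))).
  by apply: (derive_eq_on oU v Ux) => y Uy; rewrite (jacobianE oU w Uy St).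
apply: eq_mx_basis => a.
have e1 := derive_comp_mx (basis a) Ux Sxi'.
have e2 := jacobianE oV (basis a *m T x) (tV Ux) Sxi'.
have e3 : 'D_(basis a) (xi' \o t) x = 'D_(basis a) (fun y => xi y *m T y) x.
  exact: (derive_eq_on oU (basis a) Ux xit).
have e4 := derive_mulmx oU (basis a) Ux Sxi ST.
have e5 : xi x *m 'D_(basis a) T x = basis a *m 'D_(xi x) T x.
  apply: (etrans (DT (xi x) (basis a))); apply: (etrans _ (esym (DT (basis a) (xi x)))).
  exact: (Schwarz_mx oU (xi x) (basis a) Ux St).
move: ('D_(basis a) T x) ('D_(xi x) T x) e4 e5 => D1 D2 e4 e5.
rewrite mulmxDr !mulmxA -e5 (jacobian_row xi a x).
apply: (etrans (esym e2)); apply: (etrans (esym e1)); exact: (etrans e3 e4).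
Qed.

Lemma naturality_algebra (D D' K K' g g' T' dT : 'M[R]_n) :
  g = T' *m g' *m T'^T ->
  D = dT *m g' *m T'^T + T' *m D' *m T'^T + T' *m g' *m dT^T ->
  T' *m K' = K *m T' + dT ->
  D + K *m g + g *m K^T = T' *m (D' + K' *m g' + g' *m K'^T) *m T'^T.
Proof.
move=> -> -> TK.
have TKT : K'^T *m T'^T = T'^T *m K^T + dT^T by rewrite -trmx_mul TK trmx_add trmx_mul.
rewrite !(mulmxDl, mulmxDr) !mulmxA -(mulmxA _ K'^T) TKT TK !(mulmxDl, mulmxDr) !mulmxA.
move: (dT *m g' *m T'^T) (T' *m D' *m T'^T) (T' *m g' *m dT^T) (K *m T' *m g' *m T'^T)
  (T' *m g' *m T'^T *m K^T) => *.
by apply/matrixP => i j; rewrite !mxE; ring.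
Qed.

Lemma jacobian_unit x : U x -> T x \in unitmx.
Proof.
by move=> Ux; have := metric_unit pG Ux; rewrite Gt// !unitmx_mul => /andP[/andP[]].
Qed.

Lemma conj_cancel (p p' g g' T' : 'M[R]_n) : g = T' *m g' *m T'^T ->
  T' \in unitmx -> g' \in unitmx ->
  2 *: (p *m g) = T' *m (2 *: (p' *m g')) *m T'^T -> p *m T' = T' *m p'.
Proof.
move=> -> uT ug; rewrite -scalemxAr -scalemxAl => /scalerI.
rewrite pnatr_eq0 => /(_ isT); rewrite !mulmxA.
have uTt : T'^T \in unitmx by rewrite unitmx_tr.
by move=> /(can_inj (mulmxK uTt)) /(can_inj (mulmxK ug)).
Qed.

(** The Lie derivatives of the two metrics correspond under t, and both are the
    double of the metric composed with nabla xi. *)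
Lemma cov_mx_conj x : U x -> cov_mx G xi x *m T x = T x *m cov_mx G' xi' (t x).
Proof.
move=> Ux; have Vtx := tV Ux; have ST := smooth_jacobian oU St.
have SGt := smooth_comp_mx SG'.
have DG : 'D_(xi x) G x = 'D_(xi x) T x *m G' (t x) *m (T x)^T
   + T x *m 'D_(xi' (t x)) G' (t x) *m (T x)^T + T x *m G' (t x) *m ('D_(xi x) T x)^T.
  apply: (etrans (derive_eq_on oU (xi x) Ux Gt)).
  have e1 := derive_mulmx oU (xi x) Ux (smooth_mulmx oU ST SGt) (smooth_trmx oU ST).
  apply: (etrans e1).
  rewrite (derive_mulmx oU (xi x) Ux ST SGt) (derive_trmx oU (xi x) Ux ST).
  by rewrite (derive_comp_mx _ Ux SG') -xit// mulmxDl.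
have E := naturality_algebra (Gt Ux) DG (jacobian_xi Ux).
rewrite (lie_metric_mx oU SG pG Sxi cl Ux) (lie_metric_mx oV SG' pG' Sxi' cl' Vtx) in E.
exact: conj_cancel (Gt Ux) (jacobian_unit Ux) (metric_unit pG' Vtx) E.
Qed.

Lemma conj_jacobianE x (A B : 'M[R]_n) : U x -> A *m T x = T x *m B -> A = T x *m B *m invmx (T x).
Proof. by move=> Ux <-; rewrite mulmxK// jacobian_unit. Qed.

Lemma trace_conj x (A B : 'M[R]_n) : U x -> A *m T x = T x *m B -> \tr A = \tr B.
Proof.
move=> Ux /(conj_jacobianE Ux) ->; rewrite mxtrace_mulC mulmxA.
by rewrite mulVmx ?jacobian_unit// mul1mx.
Qed.

Lemma tracefree_part_conj x : U x -> tracefree_part G xi x *m T x = T x *m tracefree_part G' xi' (t x).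
Proof.
move=> Ux; have PT := cov_mx_conj Ux; have trP := trace_conj Ux PT.
rewrite /tracefree_part trP; move: (cov_mx G xi x) (cov_mx G' xi' (t x)) PT => p p' PT.
by rewrite mulmxBl mulmxBr PT scalar_mxC.
Qed.

Lemma sqr_conj x (A B : 'M[R]_n) : A *m T x = T x *m B ->
  (A *m A) *m T x = T x *m (B *m B).
Proof. by move=> AT; rewrite -mulmxA AT !mulmxA AT. Qed.

End Naturality.

(** * From global fields to charts *)

Section Germs.
Context {R : realType} {n : nat}.
Local Notation E := 'rV[R]_n.
Implicit Types (G : E -> 'M[R]_n) (X Y Z xi : E -> E) (x : E).

Lemma near_near (x : E) (Q : set E) : (\forall y \near x, Q y) ->
  \forall y \near x, \forall z \near y, Q z.
Proof. exact: nbhs_interior. Qed.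

Lemma sub3_congr (V : zmodType) (a a' b b' c c' : V) :
  a = a' -> b = b' -> c = c' -> a - b - c = a' - b' - c'.
Proof. by move=> -> -> ->. Qed.

Lemma bracket_near X X' Y Y' x : {near x, X =1 X'} -> {near x, Y =1 Y'} ->
  bracket X Y x = bracket X' Y' x.
Proof.
move=> XX YY; rewrite /bracket (nbhs_singleton XX) (nbhs_singleton YY).
by rewrite (near_eq_derive _ XX) (near_eq_derive _ YY).
Qed.

Lemma cov_near G X X' Y Y' x : {near x, X =1 X'} -> {near x, Y =1 Y'} ->
  cov G X Y x = cov G X' Y' x.
Proof.
move=> XX YY; rewrite /cov (nbhs_singleton XX) (nbhs_singleton YY).
by rewrite (near_eq_derive _ YY).
Qed.

Lemma near_bracket X X' Y Y' x : {near x, X =1 X'} -> {near x, Y =1 Y'} ->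
  {near x, bracket X Y =1 bracket X' Y'}.
Proof.
move=> /near_near XX /near_near YY; apply: filterS2 XX YY => y; exact: bracket_near.
Qed.

Lemma near_cov G X X' Y Y' x : {near x, X =1 X'} -> {near x, Y =1 Y'} ->
  {near x, cov G X Y =1 cov G X' Y'}.
Proof.
move=> /near_near XX /near_near YY; apply: filterS2 XX YY => y; exact: cov_near.
Qed.

Lemma near_refl (F : Type) (f : E -> F) x : {near x, f =1 f}.
Proof. exact: filterE. Qed.

Lemma lie_connection_near G xi X X' Y Y' x : {near x, X =1 X'} -> {near x, Y =1 Y'} ->
  lie_connection G xi X Y x = lie_connection G xi X' Y' x.
Proof.
move=> XX YY; have rx := near_refl xi x; exact: sub3_congr (bracket_near rx (near_cov G XX YY))
  (cov_near G (near_bracket rx XX) YY) (cov_near G XX (near_bracket rx YY)).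
Qed.

Lemma ricci_near G Y Y' Z Z' x : {near x, Y =1 Y'} -> {near x, Z =1 Z'} ->
  ricci G Y Z x = ricci G Y' Z' x.
Proof.
move=> YY ZZ; apply: eq_bigr => i _; rewrite /curvature.
have ri := near_refl (fun=> basis i : E) x.
have e := sub3_congr (cov_near G ri (near_cov G YY ZZ))
  (cov_near G YY (near_cov G ri ZZ)) (cov_near G (near_bracket ri YY) ZZ).
exact: (congr1 (fun w : E => w 0 i) e).
Qed.

Lemma d_dual_near G xi X X' Y Y' x : {near x, X =1 X'} -> {near x, Y =1 Y'} ->
  d_dual G xi X Y x = d_dual G xi X' Y' x.
Proof.
move=> XX YY; rewrite /d_dual (nbhs_singleton XX) (nbhs_singleton YY).
rewrite (bracket_near XX YY).
apply: (@sub3_congr R) => //; apply: near_eq_derive.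
- by apply: filterS YY => y ->.
- by apply: filterS XX => y ->.
Qed.

End Germs.

Section LocallyConstant.
Context {R : realType} {n : nat} {M : ptopologicalType} (A : manifold R n M).
Local Notation E := 'rV[R]_n.
Implicit Types (i j : chart A).

Definition chart_indep (F : chart A -> E -> R) := forall i j p,
  chart_dom i p -> chart_dom j p -> F i (coord i p) = F j (coord j p).

Lemma coord_near i p (Q : set E) : chart_dom i p ->
  (\forall y \near coord i p, Q y) -> \forall p' \near p, Q (coord i p').
Proof. by move=> ip; exact: (coord_continuous ip). Qed.

Lemma chart_dom_near i p : chart_dom i p -> \forall p' \near p, chart_dom i p'.
Proof. by move=> ip; apply: open_nbhs_nbhs; split=> //; exact: chart_dom_open. Qed.

Definition chart_gluing (F : chart A -> E -> R) (p : M) : R := F (chart_at A p) (coord (chart_at A p) p).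

Lemma chart_gluingE F i p : chart_indep F -> chart_dom i p -> chart_gluing F p = F i (coord i p).
Proof. by move=> FF ip; apply: FF => //; exact: chart_atP. Qed.

(** The glued function is locally constant, so each of its level sets is open and
    closed. *)
Lemma connected_constant F : connected [set: M] -> chart_indep F ->
  (forall i, smooth_on (chart_img i) (F i)) ->
  (forall i x a, chart_img i x -> 'D_(basis a) (F i) x = 0) ->
  forall p q, chart_gluing F p = chart_gluing F q.
Proof.
move=> cM FF SF DF.
have loc p : \forall p' \near p, chart_gluing F p' = chart_gluing F p.
  have ip := chart_atP A p; set i := chart_at A p in ip *.
  have := locally_constant (@open_chart_img _ _ _ A i) (chart_img_coord ip) (SF i)
    (fun y a => DF i y a).
  move=> /(coord_near ip) Fc; have dc := chart_dom_near ip.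
  apply: filterS2 Fc dc => p' Fc ip'.
  by rewrite !(chart_gluingE FF ip') (chart_gluingE FF ip).
move=> p q.
have : [set p' | chart_gluing F p' = chart_gluing F q] = setT.
  apply: cM; first by exists q.
  - exists [set p' | chart_gluing F p' = chart_gluing F q]; last by rewrite setTI.
    by rewrite openE => p' /= <-; exact: loc.
  - exists [set p' | chart_gluing F p' = chart_gluing F q]; last by rewrite setTI.
    rewrite -[X in closed X]setCK; apply: open_closedC.
    by rewrite openE => p' /= pq; apply: filterS (loc p') => p'' e; rewrite /= e.
by move=> /seteqP[_ /(_ p)]; apply.
Qed.

End LocallyConstant.

(** * The covariant derivative of xi is a multiple of the identity *)

Section Global.
Context {R : realType} {n : nat} {M : ptopologicalType} {A : manifold R n M}.
Local Notation E := 'rV[R]_n.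
Variables (g : metric A) (xi : vector_field A) (lambda rho : M -> R).
Hypothesis n0 : (0 < n)%N.
Hypothesis compactM : compact [set: M].
Hypothesis connectedM : connected [set: M].
Hypothesis solitonM : almost_ricci_soliton g xi lambda.
Hypothesis closed_xi : closed_field g xi.
Hypothesis affine_xi : affine_conformal_killing g xi rho.
Implicit Types (i j : chart A) (x : E).

Local Notation r i := (rho \o param i).
Local Notation nabla_xi i := (cov_mx (g i) (xi i)).

Let oi i := @open_chart_img _ _ _ A i.
Let Sg i := metric_smooth g i.
Let Sxi i := vf_smooth xi i.

Lemma metric_posdef i x : chart_img i x -> posdef (g i x).
Proof. by move=> ix; split; [exact: metric_sym|exact: metric_pos]. Qed.

Let pg i := @metric_posdef i.

Lemma smooth_rho i : smooth_on (chart_img i) (r i).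
Proof. by have [S _] := affine_xi; exact: S. Qed.

Lemma field_near i x a : chart_img i x ->
  exists X : vector_field A, {near x, X i =1 fun=> basis a}.
Proof. exact: vector_field_extension. Qed.

Lemma chart_closed i : closed_on (chart_img i) (g i) (xi i).
Proof.
move=> x a b ix; have [X XE] := field_near a ix; have [Y YE] := field_near b ix.
by rewrite -(d_dual_near (g i) (xi i) XE YE); exact: closed_xi.
Qed.

Lemma chart_affine i : affine_on (chart_img i) (g i) (xi i) (r i).
Proof.
move=> x a b ix; have [X XE] := field_near a ix; have [Y YE] := field_near b ix.
rewrite -(lie_connection_near (g i) (xi i) XE YE).
have [_ aff] := affine_xi; rewrite (aff X Y i x ix).
by rewrite (nbhs_singleton XE) (nbhs_singleton YE).
Qed.

Section ChangeOfCharts.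
Variables (i j : chart A).
Local Notation O := (overlap i j).
Local Notation t := (transition i j).

Lemma overlap_img : O `<=` chart_img i. Proof. by move=> x []. Qed.

Lemma transition_img x : O x -> chart_img j (t x).
Proof. by move=> /transition_overlap[]. Qed.

Lemma smooth_sub (F : normedModType R) (U V : set E) (f : E -> F) :
  V `<=` U -> smooth_on U f -> smooth_on V f.
Proof. by move=> VU Sf k; exact: Ck_subset VU (Sf k). Qed.

Lemma overlapP x : O x -> exists2 p, chart_dom i p /\ chart_dom j p & coord i p = x.
Proof. by rewrite -overlapE => -[p ip <-]; exists p. Qed.

Lemma xi_trans x : O x -> xi j (t x) = xi i x *m jacobian t x.
Proof.
move=> Ox; have St := @smooth_transition _ _ _ A i j.
rewrite -(jacobianE (@open_overlap _ _ _ A i j) _ Ox St).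
have [p [ip jp] <-] := overlapP Ox.
by rewrite transition_coord// (vf_change xi ip jp).
Qed.

Lemma metric_trans x : O x -> g i x = jacobian t x *m g j (t x) *m (jacobian t x)^T.
Proof.
move=> Ox; have St := @smooth_transition _ _ _ A i j.
have J u := jacobianE (@open_overlap _ _ _ A i j) u Ox St.
have [p [ip jp] xE] := overlapP Ox.
have := metric_change g ip jp; rewrite /transition_diff -/(transition i j) xE.
rewrite -[coord j p](transition_coord j ip) xE => gE.
have form_bb (S : 'M[R]_n) a b : form S (basis a) (basis b) = S a b.
  by rewrite form_basis /basis -rowE mxE.
apply/matrixP => a b; rewrite -[LHS]form_bb gE -[RHS]form_bb !J /form.
by rewrite trmx_mul !mulmxA.
Qed.

Section Conjugation.
Variable x : E.
Hypothesis Ox : O x.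

Let oO := @open_overlap _ _ _ A i j.
Let SgO := smooth_sub overlap_img (@Sg i).
Let SxiO := smooth_sub overlap_img (@Sxi i).
Let pgO y (Oy : O y) := pg (overlap_img Oy).
Let clO : closed_on O (g i) (xi i).
Proof. by move=> y a b /overlap_img; exact: chart_closed. Qed.

Lemma cov_mx_trans : nabla_xi i x *m jacobian t x = jacobian t x *m nabla_xi j (t x).
Proof.
exact: (cov_mx_conj oO (@oi j) SgO pgO SxiO clO (@Sg j) (@pg j) (@Sxi j) (@chart_closed j)
  (@smooth_transition _ _ _ A i j) transition_img metric_trans xi_trans Ox).
Qed.

Lemma tracefree_part_trans : tracefree_part (g i) (xi i) x *m jacobian t x
  = jacobian t x *m tracefree_part (g j) (xi j) (t x).
Proof.
exact: (tracefree_part_conj oO (@oi j) SgO pgO SxiO clO (@Sg j) (@pg j) (@Sxi j) (@chart_closed j)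
  (@smooth_transition _ _ _ A i j) transition_img metric_trans xi_trans Ox).
Qed.

Lemma trace_trans (B C : 'M[R]_n) : B *m jacobian t x = jacobian t x *m C -> \tr B = \tr C.
Proof. by move=> BC; exact: (trace_conj pgO metric_trans Ox BC). Qed.

End Conjugation.
End ChangeOfCharts.

Definition tr_tracefree_sqr i x := \tr (tracefree_part (g i) (xi i) x *m tracefree_part (g i) (xi i) x).
Definition tr_cov_sqr i x := \tr (nabla_xi i x *m nabla_xi i x).
Definition tr_parallel_part i x := \tr (parallel_part (g i) (xi i) (r i) x).

Lemma chart_indep_overlap (F : chart A -> E -> R) :
  (forall i j x, overlap i j x -> F i x = F j (transition i j x)) -> chart_indep F.
Proof.
by move=> H i j p ip jp; rewrite (H i j) ?transition_coord//; exact: overlap_coord.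
Qed.

Lemma tr_tracefree_sqr_indep : chart_indep tr_tracefree_sqr.
Proof.
apply: chart_indep_overlap => i j x Ox; apply: (trace_trans Ox).
by apply: sqr_conj; exact: tracefree_part_trans.
Qed.

Lemma tr_cov_sqr_indep : chart_indep tr_cov_sqr.
Proof.
apply: chart_indep_overlap => i j x Ox; apply: (trace_trans Ox).
by apply: sqr_conj; exact: cov_mx_trans.
Qed.

Lemma tr_parallel_part_indep : chart_indep tr_parallel_part.
Proof.
have trB (B : 'M[R]_n) (c : R) : \tr (B - c%:M) = \tr B - c *+ n.
  by rewrite linearB/= mxtrace_scalar.
move=> i j p ip jp; have Ox := overlap_coord ip jp.
have e := trace_trans Ox (cov_mx_trans Ox); rewrite (transition_coord j ip) in e.
have e' : r i (coord i p) = r j (coord j p) by rewrite /comp (coordK ip) (coordK jp).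
apply: (etrans (trB _ _)); apply: (etrans _ (esym (trB _ _))).
exact: (congr2 (fun u v => u - v *+ n) e e').
Qed.

Definition chart_energy i := energy (g i) (xi i).

Lemma energy_indep : chart_indep chart_energy.
Proof.
move=> i j p ip jp; rewrite /chart_energy /energy (vf_change xi ip jp).
exact: (metric_change g ip jp).
Qed.

Let SP i := smooth_cov_mx (@oi i) (@Sg i) (@pg i) (@Sxi i).

Lemma tr_tracefree_sqr_const p q : chart_gluing tr_tracefree_sqr p = chart_gluing tr_tracefree_sqr q.
Proof.
apply: (connected_constant connectedM tr_tracefree_sqr_indep) => [i|i x a ix].
  have St := smooth_tracefree_part (@oi i) (@Sg i) (@pg i) (@Sxi i).
  exact: (smooth_mxtrace (@oi i) (smooth_mulmx (@oi i) St St)).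
exact: (derive_tr_tracefree_sqr (@oi i) (@Sg i) (@pg i) (@Sxi i) (@smooth_rho i)
  (@chart_closed i) (@chart_affine i) a n0 ix).
Qed.

Lemma tr_parallel_part_const p q : chart_gluing tr_parallel_part p = chart_gluing tr_parallel_part q.
Proof.
apply: (connected_constant connectedM tr_parallel_part_indep) => [i|i x a ix].
  have SH := smooth_parallel_part (@oi i) (@Sg i) (@pg i) (@Sxi i) (@smooth_rho i).
  exact: (smooth_mxtrace (@oi i) SH).
exact: (derive_tr_parallel_part (@oi i) (@Sg i) (@pg i) (@Sxi i) (@smooth_rho i)
  (@chart_closed i) (@chart_affine i) a ix).
Qed.

Lemma chart_gluing_param (F : chart A -> E -> R) i x : chart_indep F -> chart_img i x ->
  F i x = chart_gluing F (param i x).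
Proof. by move=> FF ix; rewrite (chart_gluingE FF (param_dom ix)) paramK. Qed.

Definition concircular (f : M -> R) :=
  smooth A f /\ forall i x, chart_img i x -> nabla_xi i x = (f (param i x))%:M.

Lemma smooth_rho_add (c : R) : smooth A (fun p => rho p + c).
Proof.
move=> i; exact: (smooth_add (@oi i) (@smooth_rho i) (smooth_cst _ c)).
Qed.

(** The trace-free part of nabla xi vanishes at the given point, and tr (N^2) is
    constant. The factor is rho plus the constant tr H / (2 n). *)
Lemma concircular_nonconstant i x : chart_img i x -> differential (r i) x != 0 ->
  exists f, concircular f.
Proof.
move=> ix d0.
have H0 := parallel_part_scalar (@oi i) (@Sg i) (@pg i) (@Sxi i) (@smooth_rho i)
  (@chart_closed i) (@chart_affine i) n0 ix d0.
have N0 : tr_tracefree_sqr i x = 0.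
  rewrite /tr_tracefree_sqr (tracefree_partE _ _ (r i) x n0).
  by rewrite -H0 subrr mulmx0 mxtrace0.
have nN0 : n%:R != 0 :> R by rewrite pnatr_eq0 -lt0n.
pose c := tr_parallel_part i x / n%:R.
exists (fun p => rho p + c); split; first exact: smooth_rho_add.
move=> j y jy.
have Nj : tr_tracefree_sqr j y = 0.
  rewrite (chart_gluing_param tr_tracefree_sqr_indep jy) (tr_tracefree_sqr_const _ (param i x)).
  by rewrite -(chart_gluing_param tr_tracefree_sqr_indep ix).
have cj : tr_parallel_part j y = tr_parallel_part i x.
  rewrite (chart_gluing_param tr_parallel_part_indep jy) (tr_parallel_part_const _ (param i x)).
  by rewrite -(chart_gluing_param tr_parallel_part_indep ix).
have sP := cov_mx_sym (@oi j) (@Sg j) (@pg j) (@Sxi j) (@chart_closed j) jy.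
have sT : selfadjoint (g j y) (tracefree_part (g j) (xi j) y).
  rewrite /selfadjoint /tracefree_part mulmxBl trmx_sub sP mul_scalar_mx.
  by rewrite [X in _ - X = _]linearZ/= metric_sym.
have T0 := selfadjoint_trace_sqr_eq0 (pg jy) sT Nj.
have : tracefree_part (g j) (xi j) y = nabla_xi j y - (rho (param j y) + c)%:M.
  rewrite (tracefree_partE _ _ (r j) y n0) -/(tr_parallel_part j y) cj /parallel_part -/c.
  exact: sub_scalar_mxA.
by rewrite T0 => /esym/eqP; rewrite subr_eq0 => /eqP.
Qed.

(** Here nabla xi is parallel and vanishes at a maximum of |xi|^2, and tr (P^2) is
    constant. *)
Lemma concircular_constant : (forall i x, chart_img i x -> differential (r i) x = 0) ->
  exists f, concircular f.
Proof.
move=> d0; exists (fun=> 0); split; first by move=> i; exact: smooth_cst.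
have DP i a y : chart_img i y ->
    'D_(basis a) (nabla_xi i) y = christoffel_mx (g i) a y *m nabla_xi i y - nabla_xi i y *m christoffel_mx (g i) a y.
  move=> iy; rewrite (derive_cov_mx (@oi i) (@Sg i) (@pg i) (@Sxi i) (@chart_closed i) (@chart_affine i) a iy).
  have := d0 i y iy => /rowP/(_ a); rewrite [LHS]mxE [RHS]mxE => ->.
  by rewrite scalar_mx0 add0r.
have P2const p q : chart_gluing tr_cov_sqr p = chart_gluing tr_cov_sqr q.
  apply: (connected_constant connectedM tr_cov_sqr_indep) => [i|i x a ix].
    exact: (smooth_mxtrace (@oi i) (smooth_mulmx (@oi i) (@SP i) (@SP i))).
  by apply: (derive_trace_sqr (@oi i) ix (@SP i)); exact: DP.
have cE : continuous (chart_gluing chart_energy).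
  move=> p; have ip := chart_atP A p; set i := chart_at A p in ip *.
  have Ec := Ck_continuous (smooth_energy (@oi i) (@Sg i) (@Sxi i) 0) (chart_img_coord ip).
  have c : {for p, continuous (chart_energy i \o coord i)}.
    by apply: continuous_comp Ec; exact: (coord_continuous ip).
  rewrite /continuous_at (chart_gluingE energy_indep ip); apply: cvg_trans c.
  apply: near_eq_cvg; apply: filterS (chart_dom_near ip) => q iq.
  by rewrite (chart_gluingE energy_indep iq).
have [p _ pmax] : exists2 p, p \in [set: M] &
    forall q, q \in [set: M] -> chart_gluing chart_energy q <= chart_gluing chart_energy p.
  apply: compact_EVT_max => //; first by exists point.
  by apply: continuous_subspaceT.
pose i := chart_at A p; have ip : chart_dom i p := chart_atP A p.
have P0 : nabla_xi i (coord i p) = 0.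
  apply: (energy_max (@oi i) (@Sg i) (@pg i) (@Sxi i) (DP i)).
    exact: chart_img_coord.
  move=> y iy; have := pmax (param i y); rewrite inE => /(_ I).
  by rewrite -(chart_gluing_param energy_indep iy) (chart_gluingE energy_indep ip).
move=> j y jy; rewrite scalar_mx0.
apply: (selfadjoint_trace_sqr_eq0 (pg jy)).
  exact: (cov_mx_sym (@oi j) (@Sg j) (@pg j) (@Sxi j) (@chart_closed j) jy).
rewrite -/(tr_cov_sqr j y) (chart_gluing_param tr_cov_sqr_indep jy) (P2const _ p) (chart_gluingE tr_cov_sqr_indep ip).
by rewrite /tr_cov_sqr P0 mulmx0 mxtrace0.
Qed.

Lemma concircular_exists : exists f, concircular f.
Proof.
have [[i [x [ix d0]]]|H] := pselect (exists i x, chart_img i x /\ differential (r i) x != 0).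
  exact: concircular_nonconstant ix d0.
apply: concircular_constant => i x ix; apply/eqP/negP => /negP d0.
by apply: H; exists i, x.
Qed.

Lemma conformal_of_concircular f (X Y : vector_field A) i x : concircular f -> chart_img i x ->
  lie_metric (g i) (xi i) (X i) (Y i) x = 2 * f (param i x) * form (g i x) (X i x) (Y i x).
Proof.
move=> [_ Pf] ix.
rewrite (lie_metricE (@oi i) (@Sg i) (@pg i) (@Sxi i) (@chart_closed i) ix (vf_smooth X i) (vf_smooth Y i)).
by rewrite Pf// mul_scalar_mx -scalemxAr -scalemxAl [X in _ * X]mxE mulrA.
Qed.

Lemma ricci_of_concircular f (X Y : vector_field A) i x : concircular f -> chart_img i x ->
  ricci (g i) (X i) (Y i) x = (lambda (param i x) - f (param i x)) * form (g i x) (X i x) (Y i x).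
Proof.
move=> hf ix; have [_ sol] := solitonM; have := sol X Y i x ix.
rewrite (conformal_of_concircular _ _ hf ix) => E.
by rewrite mulrBl -E; field.
Qed.

Lemma einstein_of_concircular f : concircular f -> einstein g.
Proof.
move=> hf X Y i x ix; rewrite (ricci_of_concircular _ _ hf ix); congr (_ * _).
have nN0 : n%:R != 0 :> R by rewrite pnatr_eq0 -lt0n.
apply: (mulIf nN0); rewrite divfK//.
set l := _ - _.
have Rab a b : ricci (g i) (fun=> basis a) (fun=> basis b) x = l * g i x b a.
  have [X' XE] := field_near a ix; have [Y' YE] := field_near b ix.
  rewrite -(ricci_near (g i) XE YE) (ricci_of_concircular _ _ hf ix) -/l.
  rewrite (nbhs_singleton XE) (nbhs_singleton YE) form_basis; congr (_ * _).
  by rewrite -[in LHS](metric_sym g ix) /basis -rowE [LHS]mxE [LHS]mxE.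
rewrite /scalar_curvature.
transitivity (l * \tr (invmx (g i x) *m g i x)).
  by rewrite mulVmx ?(posdef_unit (pg ix))// mxtrace1.
rewrite mulr_sumr; apply: eq_bigr => a _; rewrite mxE mulr_sumr.
by apply: eq_bigr => b _; rewrite Rab mulrCA.
Qed.

End Global.

Theorem proposition4p5 (R : realType) (n : nat) (M : ptopologicalType)
    (A : manifold R n M) (g : metric A)
    (mu : {measure set (g_sigma_algebraType (@open M)) -> \bar R})
    (xi : vector_field A) (lambda rho : M -> R)
    (n_gt2 : (2 < n)%N)
    (compactM : compact [set: M])
    (connectedM : connected [set: M])
    (muP : riemannian_measure g mu)
    (solitonM : almost_ricci_soliton g xi lambda)
    (closed_xi : closed_field g xi)
    (affine_xi : affine_conformal_killing g xi rho)
    (ricci_ge :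
      n%:R * (\int[mu]_(p in setT)
                (rho p * ((n%:R - 1) * rho p + traceH g xi rho p)))%R
      + (n%:R - 1) / (4 * n%:R)
          * (\int[mu]_(p in setT) (traceH g xi rho p ^+ 2))%R
      <= (\int[mu]_(p in setT) (ricci_at g xi xi p))%R) :
  conformal_killing g xi /\ einstein g.
Proof.
have n0 : (0 < n)%N by exact: leq_trans n_gt2.
have [f hf] := concircular_exists n0 compactM connectedM closed_xi affine_xi.
split; last exact: (einstein_of_concircular n0 solitonM closed_xi hf).
exists f; split; first by case: hf.
by move=> X Y i x ix; exact: conformal_of_concircular hf ix.
Qed.
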